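(* Let $(X,b,m)$ be a weighted graph satisfying (C), (B), (M). Assume $D\subsetneq X$ is $d_L$-relatively dense and set $\Omega:=X\setminus D$. Let $T>0$, $\delta\in[0,1)$, $r\in[1,\infty]$. Define $\lambda$ by $2\lambda=(\operatorname{Inr}(\Omega)\operatorname{vol}(\operatorname{Inr}(\Omega)))^{-1}$, $\kappa:=8\|H+1\|^2\operatorname{Inr}(\Omega)\operatorname{vol}(\operatorname{Inr}(\Omega))$, $K:=\kappa/((1-\delta)T)^{1/r}$ and $\alpha:=(\kappa+1)e^{-\delta\lambda T}$, where all metric quantities are taken with respect to $d_L$. Then for all $\varphi_0\in\ell_2(X,m)$, \[\|S_T\varphi_0\|\le K\,\|(S_{(\cdot)}\varphi_0)|_D\|_{L_r((\delta T,T);\ell_2(D,m|_D))}+\alpha\|\varphi_0\|.\]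
   Context: A weighted graph $(X,b,m)$: $X$ countable, $m\colon X\to(0,\infty)$ (measure $m(A)=\sum_{x\in A}m(x)$), $b\colon X\times X\to[0,\infty)$ symmetric with $b(x,x)=0$ and $\sum_y b(x,y)<\infty$. Paths: $(x_0,\dots,x_k)$ with $b(x_j,x_{j+1})>0$. Assumptions: (C) connected; (B) $\sup_x\operatorname{Deg}(x)<\infty$, $\operatorname{Deg}(x)=\frac1{m(x)}\sum_yb(x,y)$; (M) $\sup_xm(x)<\infty$. Length metric: $d_L(x,y)=\inf\{\sum_{j}1/b(x_j,x_{j+1}) : (x_0,\dots,x_k)\text{ path from }x\text{ to }y\}$ for $x\neq y$. For the metric $d=d_L$: $U_r(x)=\{y:d(x,y)<r\}$, $B_r(x)=\{y:d(x,y)\le r\}$; $D$ is relatively dense if $\inf\{R>0:\bigcup_{x\in D}B_R(x)=X\}<\infty$; inradius $\operatorname{Inr}(\Omega)=\sup\{r>0:\exists x\in\Omega,\ U_r(x)\subseteq\Omega\}$; $\operatorname{vol}(r)=\sup_{x\in X}m(B_r(x))$. $H$ is the weighted Laplacian $Hf(x)=\frac1{m(x)}\sum_yb(x,y)(f(x)-f(y))$ on $\ell_2(X,m)$ (bounded, self-adjoint, non-negative), $\|H+1\|$ its operator norm, and $S_t=e^{-tH}$. *)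

(* Defs.v *)
From HB Require Import structures.
From mathcomp Require Import all_boot all_order all_algebra.
From mathcomp Require Import all_classical all_reals all_analysis.
Set Implicit Arguments. Unset Strict Implicit. Unset Printing Implicit Defensive.
Import Order.TTheory GRing.Theory Num.Theory.
Import numFieldNormedType.Exports.
Local Open Scope classical_set_scope.
Local Open Scope ring_scope.

Section WeightedGraph.
Context {R : realType} {X : countType}.
Implicit Types (b : X -> X -> R) (m : X -> R) (f : X -> R) (A : set X).

(* Sum over A of a real family: (sum of positive parts) - (sum of negative
   parts); equals the usual sum whenever f is absolutely summable on A. *)
Definition sumX A f : R :=
  fine (\esum_(x in A) (Num.max (f x) 0)%:E)
  - fine (\esum_(x in A) (Num.max (- f x) 0)%:E).

Definition Deg b m (x : X) : R := (m x)^-1 * sumX setT (b x).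

Definition is_path b (x : X) (ps : seq X) : bool := path (fun u v => 0 < b u v) x ps.

Fixpoint plen b (x : X) (ps : seq X) : R :=
  match ps with
  | [::] => 0
  | y :: ps' => (b x y)^-1 + plen b y ps'
  end.

Definition connected_graph b : Prop :=
  forall x y : X, exists ps : seq X, is_path b x ps && (last x ps == y).

Definition dL b (x y : X) : R :=
  if x == y then 0
  else inf [set l | exists ps : seq X,
                      [/\ is_path b x ps, last x ps = y & l = plen b x ps]].

Definition Uball b (r : R) (x : X) : set X := [set y | dL b x y < r].
Definition Bball b (r : R) (x : X) : set X := [set y | dL b x y <= r].

Definition rel_dense b (D : set X) : Prop :=
  exists R0 : R, 0 < R0 /\ \bigcup_(x in D) Bball b R0 x = setT.

Definition inradius b (Om : set X) : R :=
  sup [set r : R | 0 < r /\ exists2 x, Om x & Uball b r x `<=` Om].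

Definition meas m A : R := fine (\esum_(x in A) (m x)%:E).

Definition vol b m (r : R) : R := sup [set meas m (Bball b r x) | x in setT].

Definition in_l2 m f : Prop := (\esum_(x in setT) (f x ^+ 2 * m x)%:E < +oo)%E.
Definition norm2 m A f : R := Num.sqrt (fine (\esum_(x in A) (f x ^+ 2 * m x)%:E)).

Definition Lap b m f : X -> R :=
  fun x => (m x)^-1 * sumX setT (fun y => b x y * (f x - f y)).

Definition opnorm_H1 b m : R :=
  sup [set norm2 m setT (fun x => Lap b m f x + f x) |
        f in [set f | in_l2 m f /\ norm2 m setT f <= 1]].

(* heat semigroup S_t = e^{-tH} = sum_k (-t)^k H^k / k!  (H is bounded, and
   the series converges in l2, hence pointwise) *)
Definition heat b m (t : R) f : X -> R :=
  fun x => limn (series (fun k : nat => (- t) ^+ k / (k`!)%:R * iter k (Lap b m) f x)).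

End WeightedGraph.

(* Main.v *)
Require Import Defs.
From HB Require Import structures.
From mathcomp Require Import all_boot all_order all_algebra finmap.
From mathcomp Require Import all_classical all_reals all_analysis.
From mathcomp Require Import ring lra.
Import Order.TTheory GRing.Theory Num.Theory.
Import numFieldNormedType.Exports.
Import HBNNSimple.
Local Open Scope classical_set_scope.
Local Open Scope ring_scope.
Set Implicit Arguments. Unset Strict Implicit. Unset Printing Implicit Defensive.

(* Write Q for the energy form, H for the Laplacian, u_t for S_t phi, a for Inr vol(Inr), so that
   lambda = 1 / (2a).

   A shortest-path forest rooted in D yields the Poincare inequality |f|^2 <= a Q(f) for f vanishing
   on D: the tree path from x to D has length at most Inr, and the points whose tree path runs
   through u lie in the ball B_Inr(u).

   No spectral calculus is needed. Fix t < T and distinguish two cases.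
   - If Q(u_t) <= lambda |u_t|^2, the Poincare inequality applied to u_t 1_Omega absorbs the part of
     u_t off D and gives |u_t| <= kappa |u_t 1_D|.
   - Otherwise the moments <H^n u_t, u_t> are log-convex with first ratio at least lambda, so they
     dominate lambda^n |u_t|^2. Expanding |u_(t-s)|^2 = sum_n (2s)^n / n! <H^n u_t, u_t> then gives
     |u_(t-s)|^2 >= e^(2 lambda s) |u_t|^2, and s = t yields |u_t| <= e^(- lambda t) |phi|.
   The same expansion with 0 in place of lambda shows that |u_t| decreases. Hence |u_T| is bounded
   by kappa |u_t 1_D| + e^(- lambda t) |phi| for every t in (delta T, T), and the L_r norm of t |-> |u_t 1_D|
   is at least (length)^(1/r) times any constant lower bound. *)

(** * Sums over countable types *)

Section Summation.
Context {R : realType}.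

(** Absolute summability. Since [fine] sends an infinite sum to 0, the algebraic rules for [sumX]
    hold in general only under this condition. *)
Definition summ {I : countType} (f : I -> R) : Prop :=
  (\esum_(x in setT) `|f x|%:E < +oo)%E.

Lemma summ_le {I : countType} (f g : I -> R) :
  summ g -> (forall x, `|f x| <= g x) -> summ f.
Proof.
move=> sg fg; apply: le_lt_trans sg; apply: le_esum => x _.
by rewrite lee_fin (le_trans (fg x))// ler_norm.
Qed.

Lemma eq_summ {I : countType} (f g : I -> R) : f =1 g -> summ f -> summ g.
Proof. by move=> /funext ->. Qed.

Lemma summ_norm {I : countType} (f : I -> R) : summ f -> summ (fun x => `|f x|).
Proof. by move=> sf; apply: le_lt_trans sf; apply: le_esum => x _; rewrite normr_id. Qed.

Lemma summD {I : countType} (f g : I -> R) :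
  summ f -> summ g -> summ (fun x => f x + g x).
Proof.
move=> sf sg; apply: (@le_lt_trans _ _ (\esum_(x in setT) (`|f x|%:E + `|g x|%:E))%E).
  by apply: le_esum => x _; rewrite -EFinD lee_fin ler_normD.
by rewrite esumD// ?lte_add_pinfty.
Qed.

Lemma le_esumZ {I : countType} (c : R) (a : I -> \bar R) : 0 <= c ->
  (forall x, 0 <= a x)%E ->
  (\esum_(x in setT) (c%:E * a x) <= c%:E * \esum_(x in setT) a x)%E.
Proof.
move=> c0 a0; rewrite ge_ereal_sup => //= _ [A [finA _]] <-.
rewrite -ge0_mule_fsumr//; apply: lee_wpmul2l; first by rewrite lee_fin.
by apply: ereal_sup_ubound; exists A.
Qed.

(** For [c != 0] the missing inequality is [le_esumZ] applied to [c^-1] and the scaled family. *)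
Lemma esumZ {I : countType} (c : R) (a : I -> \bar R) : 0 <= c ->
  (forall x, 0 <= a x)%E ->
  (\esum_(x in setT) (c%:E * a x) = c%:E * \esum_(x in setT) a x)%E.
Proof.
move=> c0 a0; apply/eqP; rewrite eq_le le_esumZ//=.
have [->|cn0] := eqVneq c 0.
  by rewrite mul0e; apply: esum_ge0 => x _; rewrite mul0e.
have c1 : 0 <= c^-1 by rewrite invr_ge0.
have ca0 x : (0 <= c%:E * a x)%E by rewrite mule_ge0// lee_fin.
have := @le_esumZ _ _ _ c1 ca0.
under eq_esum do rewrite muleA -EFinM mulVf// mul1e.
move=> H; have := @lee_wpmul2l _ c%:E _ _ _ H; rewrite lee_fin => /(_ c0).
by rewrite muleA -EFinM divff// mul1e.
Qed.

Lemma summZ {I : countType} (c : R) (f : I -> R) : summ f -> summ (fun x => c * f x).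
Proof.
move=> sf; rewrite /summ; under eq_esum do rewrite normrM EFinM.
rewrite esumZ//; rewrite lte_mul_pinfty//.
Qed.

Lemma summN {I : countType} (f : I -> R) : summ f -> summ (fun x => - f x).
Proof. by move=> sf; apply: le_lt_trans sf; apply: le_esum => x _; rewrite normrN. Qed.

Lemma summB {I : countType} (f g : I -> R) :
  summ f -> summ g -> summ (fun x => f x - g x).
Proof. by move=> sf sg; apply: summD => //; exact: summN. Qed.

Lemma summ_ge0 {I : countType} (f : I -> R) : (forall x, 0 <= f x) ->
  (\esum_(x in setT) (f x)%:E < +oo)%E -> summ f.
Proof. by move=> f0; apply: le_lt_trans; apply: le_esum => x _; rewrite ger0_norm. Qed.

Lemma sumX_fine {I : countType} (A : set I) (f : I -> R) : (forall x, 0 <= f x) ->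
  sumX A f = fine (\esum_(x in A) (f x)%:E).
Proof.
move=> f0; rewrite /sumX.
rewrite (_ : (\esum_(x in A) (Num.max (- f x) 0)%:E)%E = 0%E); last first.
  by rewrite esum1// => x _; rewrite max_r// oppr_le0.
rewrite subr0; congr fine; apply: eq_esum => x _; rewrite max_l//.
Qed.

Lemma sumXE {I : countType} (f : I -> R) : (forall x, 0 <= f x) -> summ f ->
  (\esum_(x in setT) (f x)%:E)%E = (sumX setT f)%:E.
Proof.
move=> f0 sf; rewrite sumX_fine// fineK// ge0_fin_numE; last first.
  by apply: esum_ge0 => x _; rewrite lee_fin.
by apply: le_lt_trans sf; apply: le_esum => x _; rewrite lee_fin ler_norm.
Qed.

Lemma sumX_ge0 {I : countType} (f : I -> R) : (forall x, 0 <= f x) -> 0 <= sumX setT f.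
Proof.
by move=> f0; rewrite sumX_fine// fine_ge0//; apply: esum_ge0 => x _; rewrite lee_fin.
Qed.

Lemma eq_sumX {I : countType} (A : set I) (f g : I -> R) : f =1 g -> sumX A f = sumX A g.
Proof. by move=> /funext ->. Qed.

Lemma ge0_sumXD {I : countType} (f g : I -> R) :
  (forall x, 0 <= f x) -> (forall x, 0 <= g x) -> summ f -> summ g ->
  sumX setT (fun x => f x + g x) = sumX setT f + sumX setT g.
Proof.
move=> f0 g0 sf sg; apply: EFin_inj.
rewrite -sumXE; [|by move=> x; rewrite addr_ge0|exact: summD].
by rewrite EFinD -!sumXE// -esumD// => x _; rewrite lee_fin.
Qed.

Lemma sumX_posneg {I : countType} (f : I -> R) :
  sumX setT f = sumX setT (fun x => Num.max (f x) 0) - sumX setT (fun x => Num.max (- f x) 0).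
Proof. by rewrite [LHS]/sumX -!sumX_fine// => x; rewrite le_max lexx orbT. Qed.

Lemma summ_pos {I : countType} (f : I -> R) : summ f -> summ (fun x => Num.max (f x) 0).
Proof.
move=> /summ_norm sf; apply: summ_le sf _ => x.
by rewrite ger0_norm ?le_max ?lexx ?orbT// ge_max normr_ge0 ler_norm.
Qed.

Lemma summ_neg {I : countType} (f : I -> R) : summ f -> summ (fun x => Num.max (- f x) 0).
Proof. by move=> sf; apply: summ_pos; exact: summN. Qed.

Lemma pos_sub_neg (x : R) : Num.max x 0 - Num.max (- x) 0 = x.
Proof.
have [x0|x0] := leP 0 x; first by rewrite max_r ?oppr_le0// subr0.
by rewrite max_l ?sub0r ?opprK// oppr_ge0 ltW.
Qed.

(** The positive part u and the negative part v of p - q satisfy u + q = p + v. This is an identity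
    between nonnegative families, where additivity is already known. *)
Lemma ge0_sumXB {I : countType} (p q : I -> R) :
  (forall x, 0 <= p x) -> (forall x, 0 <= q x) -> summ p -> summ q ->
  sumX setT (fun x => p x - q x) = sumX setT p - sumX setT q.
Proof.
move=> p0 q0 sp sq; rewrite sumX_posneg.
set u := fun x => Num.max (p x - q x) 0; set v := fun x => Num.max (- (p x - q x)) 0.
have su : summ u by apply: summ_pos; exact: summB.
have sv : summ v by apply: summ_neg; exact: summB.
have u0 x : 0 <= u x by rewrite le_max lexx orbT.
have v0 x : 0 <= v x by rewrite le_max lexx orbT.
have : sumX setT (fun x => u x + q x) = sumX setT (fun x => p x + v x).
  by apply: eq_sumX => x; have := pos_sub_neg (p x - q x); rewrite /u /v; lra.
by rewrite !ge0_sumXD//; lra.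
Qed.

Lemma sumXD {I : countType} (f g : I -> R) : summ f -> summ g ->
  sumX setT (fun x => f x + g x) = sumX setT f + sumX setT g.
Proof.
move=> sf sg; rewrite (sumX_posneg f) (sumX_posneg g).
have sfp := summ_pos sf; have sfn := summ_neg sf.
have sgp := summ_pos sg; have sgn := summ_neg sg.
rewrite (_ : _ - _ + _ = (sumX setT (fun x => Num.max (f x) 0) + sumX setT (fun x => Num.max (g x) 0)) - (sumX setT (fun x => Num.max (- f x) 0) + sumX setT (fun x => Num.max (- g x) 0))); last by lra.
have m0 (h : I -> R) x : 0 <= Num.max (h x) 0 by rewrite le_max lexx orbT.
rewrite -!ge0_sumXD//; try exact: (m0 (fun x => - f x)); try exact: (m0 (fun x => - g x)).
rewrite -ge0_sumXB//; try (by move=> x; rewrite addr_ge0 ?(m0 f) ?(m0 g) ?(m0 (fun x => - f x)) ?(m0 (fun x => - g x))); try exact: summD.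
apply: eq_sumX => x; have := pos_sub_neg (f x); have := pos_sub_neg (g x); lra.
Qed.

Lemma sumXN {I : countType} (f : I -> R) : sumX setT (fun x => - f x) = - sumX setT f.
Proof.
rewrite /sumX opprB; congr (_ - _).
by congr fine; apply: eq_esum => x _; rewrite opprK.
Qed.

Lemma sumXB {I : countType} (f g : I -> R) : summ f -> summ g ->
  sumX setT (fun x => f x - g x) = sumX setT f - sumX setT g.
Proof. by move=> sf sg; rewrite sumXD ?sumXN//; exact: summN. Qed.

Lemma sumXZ {I : countType} (c : R) (f : I -> R) : summ f ->
  sumX setT (fun x => c * f x) = c * sumX setT f.
Proof.
have m0 (h : I -> R) x : 0 <= Num.max (h x) 0 by rewrite le_max lexx orbT.
have P (d : R) (g : I -> R) : 0 <= d -> summ g -> (forall x, 0 <= g x) ->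
    sumX setT (fun x => d * g x) = d * sumX setT g.
  move=> d0 sg g0; apply: EFin_inj; rewrite -sumXE.
  - by rewrite EFinM -sumXE// -esumZ.
  - by move=> x; rewrite mulr_ge0.
  - exact: summZ.
have Q (d : R) (g : I -> R) : 0 <= d -> summ g ->
    sumX setT (fun x => d * g x) = d * sumX setT g.
  move=> d0 sg; rewrite (sumX_posneg g) mulrBr -!P//; try exact: (m0 (fun x => - g x)); try exact: summ_pos; try exact: summ_neg.
  rewrite -sumXB; [|exact/summZ/summ_pos|exact/summZ/summ_neg].
  by apply: eq_sumX => x; rewrite -mulrBr pos_sub_neg.
move=> sf; have [c0|c0] := leP 0 c; first exact: Q.
rewrite -[c]opprK mulNr -Q ?oppr_ge0 ?ltW// -sumXN.
by apply: eq_sumX => x; rewrite mulNr.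
Qed.

Lemma le_sumX {I : countType} (f g : I -> R) : summ f -> summ g ->
  (forall x, f x <= g x) -> sumX setT f <= sumX setT g.
Proof.
move=> sf sg fg; rewrite -subr_ge0 -sumXB//; apply: sumX_ge0 => x.
by rewrite subr_ge0.
Qed.

Lemma ler_norm_sumX {I : countType} (f : I -> R) : summ f ->
  `|sumX setT f| <= sumX setT (fun x => `|f x|).
Proof.
move=> sf; have sa := summ_norm sf; rewrite ler_norml -sumXN.
apply/andP; split; apply: le_sumX => //.
- exact: summN.
- by move=> x; rewrite lerNl ler_normr lexx orbT.
- by move=> x; exact: ler_norm.
Qed.

Lemma esum_prod {I J : countType} (a : I * J -> \bar R) : (forall p, 0 <= a p)%E ->
  (\esum_(p in setT) a p = \esum_(i in setT) \esum_(j in setT) a (i, j))%E.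
Proof.
move=> a0; rewrite (@esum_esum _ _ _ setT (fun=> setT) (fun i j => a (i, j)))//.
rewrite (_ : (setT `*`` _) = setT); last by apply/seteqP; split.
by apply: eq_esum => -[].
Qed.

Lemma summ_prod {I J : countType} (f : I * J -> R) :
  (forall i, summ (fun j => f (i, j))) ->
  summ (fun i => sumX setT (fun j => `|f (i, j)|)) -> summ f.
Proof.
move=> s1 s2; rewrite /summ.
have E : (\esum_(x in setT) `|f x|%:E = \esum_(i in setT) \esum_(j in setT) `|f (i, j)|%:E)%E.
  by rewrite (@esum_prod _ _ (fun p => `|f p|%:E))// => p /=; rewrite lee_fin.
rewrite E; apply: le_lt_trans s2; apply: le_esum => i _.
by rewrite sumXE// ?lee_fin ?ler_norm//; exact/summ_norm/s1.
Qed.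

Lemma summ_section {I J : countType} (f : I * J -> R) i : summ f -> summ (fun j => f (i, j)).
Proof.
move=> sf; apply: le_lt_trans sf.
have -> : (\esum_(x in setT) `|f x|%:E = \esum_(i in setT) \esum_(j in setT) `|f (i, j)|%:E)%E.
  by rewrite (@esum_prod _ _ (fun p => `|f p|%:E))// => p /=; rewrite lee_fin.
rewrite (esumID [set i])//; last first.
  by move=> k _; apply: esum_ge0 => *; rewrite lee_fin.
rewrite setTI esum_set1; last by apply: esum_ge0 => *; rewrite lee_fin.
rewrite leeDl//; apply: esum_ge0 => k _; apply: esum_ge0 => *; rewrite lee_fin//.
Qed.

Lemma ge0_sumX_prod {I J : countType} (f : I * J -> R) : (forall x, 0 <= f x) ->
  summ f -> summ (fun i => sumX setT (fun j => f (i, j))) /\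
  sumX setT f = sumX setT (fun i => sumX setT (fun j => f (i, j))).
Proof.
move=> f0 sf.
have E : (\esum_(x in setT) (f x)%:E = \esum_(i in setT) \esum_(j in setT) (f (i, j))%:E)%E.
  by rewrite (@esum_prod _ _ (EFin \o f))// => p /=; rewrite lee_fin.
have s : summ (fun i => sumX setT (fun j => f (i, j))).
  apply: summ_ge0 => [x|]; first by apply: sumX_ge0 => j.
  rewrite (_ : (\esum_(i in setT) _)%E = (\esum_(x in setT) (f x)%:E)%E).
    by rewrite sumXE// ltry.
  by rewrite E; apply: eq_esum => i _; rewrite sumXE//; exact: summ_section.
split=> //; apply: EFin_inj; rewrite -!sumXE//; last by move=> i; apply: sumX_ge0 => j.
by rewrite E; apply: eq_esum => i _; rewrite sumXE//; exact: summ_section.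
Qed.

Lemma summ_sumX {I J : countType} (f : I * J -> R) : summ f ->
  summ (fun i => sumX setT (fun j => f (i, j))).
Proof.
move=> sf; have [s _] := ge0_sumX_prod (fun x => normr_ge0 (f x)) (summ_norm sf).
by apply: summ_le s _ => i; apply: ler_norm_sumX; exact: summ_section.
Qed.

(** Fubini, obtained from Tonelli on the positive and the negative part. *)
Lemma sumX_prod {I J : countType} (f : I * J -> R) : summ f ->
  sumX setT f = sumX setT (fun i => sumX setT (fun j => f (i, j))).
Proof.
move=> sf; have m0 (h : I * J -> R) x : 0 <= Num.max (h x) 0 by rewrite le_max lexx orbT.
have [s1 e1] := ge0_sumX_prod (m0 f) (summ_pos sf).
have [s2 e2] := ge0_sumX_prod (m0 (fun x => - f x)) (summ_neg sf).
rewrite sumX_posneg e1 e2 -sumXB//; apply: eq_sumX => i.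
by rewrite [RHS]sumX_posneg.
Qed.

Lemma esum_bij {I J : countType} (e : J -> I) (a : I -> \bar R) : bijective e ->
  (\esum_(i in setT) a i = \esum_(j in setT) a (e j))%E.
Proof.
move=> be; apply: reindex_esum; split => //; first by move=> x y _ _ /(bij_inj be).
by have [g _ eg] := be; move=> x _ /=; exists (g x) => //; exact: eg.
Qed.

Lemma sumX_bij {I J : countType} (e : J -> I) (f : I -> R) : bijective e ->
  sumX setT f = sumX setT (fun j => f (e j)).
Proof. by move=> be; rewrite /sumX !(esum_bij _ be). Qed.

Lemma summ_bij {I J : countType} (e : J -> I) (f : I -> R) : bijective e ->
  summ f -> summ (fun j => f (e j)).
Proof. by move=> be; rewrite /summ (esum_bij _ be). Qed.

Definition swap {I J : Type} (p : I * J) : J * I := (p.2, p.1).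

Lemma swap_bij {I J : Type} : bijective (@swap I J).
Proof. by exists (@swap J I) => -[]. Qed.

Lemma summ_swap {I J : countType} (f : I * J -> R) : summ f -> summ (fun p => f (p.2, p.1)).
Proof. exact: summ_bij swap_bij. Qed.

Lemma sumX_swap {I J : countType} (f : I * J -> R) :
  sumX setT f = sumX setT (fun p => f (p.2, p.1)).
Proof. exact: sumX_bij swap_bij. Qed.

Lemma exchange_sumX {I J : countType} (f : I -> J -> R) : summ (fun p => f p.1 p.2) ->
  sumX setT (fun i => sumX setT (f i)) = sumX setT (fun j => sumX setT (f^~ j)).
Proof.
move=> sf; have -> := esym (sumX_prod sf).
by rewrite sumX_swap sumX_prod//; exact: (summ_swap sf).
Qed.

Lemma sumX_single {I : countType} (i0 : I) (f : I -> R) :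
  (forall i, i != i0 -> f i = 0) -> summ f /\ sumX setT f = f i0.
Proof.
move=> f0.
have E (g : I -> \bar R) : (forall i, 0 <= g i)%E -> (forall i, i != i0 -> g i = 0%E) ->
    (\esum_(i in setT) g i = g i0)%E.
  move=> g0 gn; rewrite (esumID [set i0])// setTI esum_set1//.
  by rewrite esum1 ?adde0// => i [_ /eqP/gn].
split; first by rewrite /summ E ?ltry// => i /f0 ->; rewrite normr0.
rewrite /sumX !E /= ?pos_sub_neg// => i; rewrite ?lee_fin ?le_max ?lexx ?orbT//.
  by move=> /f0 ->; rewrite oppr0 maxxx.
by move=> /f0 ->; rewrite maxxx.
Qed.

End Summation.

(** * Cauchy-Schwarz and Cauchy products *)

Section CauchyProduct.
Context {R : realType}.

Lemma quad_discr (A B C : R) : (forall s, 0 <= A - 2 * s * B + s ^+ 2 * C) -> B ^+ 2 <= A * C.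
Proof.
move=> H; have [C0|C0|C0] := ltgtP C 0.
- have A0 : 0 <= A by have := H 0; rewrite expr0n/=; lra.
  (* The case C < 0 is contradictory: here s > A and s * C <= -1, so averaging the hypothesis at s
     and -s gives 0 <= A + s^2 C <= A - s < 0. *)
  pose s := A + 1 - C^-1.
  have Ci : C^-1 < 0 by rewrite invr_lt0.
  have sC : s * C = (A + 1) * C - 1 by rewrite /s mulrBl mulVf// lt_eqF.
  have sC1 : s * C <= -1 by rewrite sC; nra.
  have h1 := H s; have := H (- s); rewrite sqrrN => h2.
  have : s * (s * C) <= s * -1 by rewrite ler_wpM2l// /s; lra.
  have : A < s by rewrite /s; lra.
  nra.
- have := H (B / C) => h.
  have : 0 <= C * (A - 2 * (B / C) * B + (B / C) ^+ 2 * C) by rewrite mulr_ge0// ltW.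
  rewrite (_ : C * _ = A * C - B ^+ 2); first by lra.
  by field; rewrite gt_eqF.
- subst C; rewrite mulr0; have A0 : 0 <= A by have := H 0; rewrite expr0n/=; lra.
  (* For C = 0 and B nonzero the polynomial is affine, and this s gives it the value -1. *)
  have := H ((A + 1) / (2 * B)).
  have [->|B0] := eqVneq B 0; first by rewrite expr0n.
  rewrite (_ : A - _ + _ = -1); first by lra.
  by field.
Qed.

Lemma summ_wM {I : countType} (w f g : I -> R) : (forall i, 0 <= w i) ->
  summ (fun i => w i * f i ^+ 2) -> summ (fun i => w i * g i ^+ 2) ->
  summ (fun i => w i * (f i * g i)).
Proof.
move=> w0 sf sg; apply: summ_le (summD sf sg) _ => i.
rewrite normrM (ger0_norm (w0 i)) -mulrDr ler_wpM2l// ler_norml.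
by apply/andP; split; have := sqr_ge0 (f i + g i); have := sqr_ge0 (f i - g i);
  have := sqr_ge0 (f i); have := sqr_ge0 (g i); nra.
Qed.

(** The sum of w (f - s g)^2 is nonnegative for every s; take the discriminant in s. The weight will
    be m for l2, b/2 for the energy form, [b x] for the Laplacian at x, and exponential coefficients
    for the heat series. *)
Lemma sumX_CS {I : countType} (w f g : I -> R) : (forall i, 0 <= w i) ->
  summ (fun i => w i * f i ^+ 2) -> summ (fun i => w i * g i ^+ 2) ->
  sumX setT (fun i => w i * (f i * g i)) ^+ 2 <=
  sumX setT (fun i => w i * f i ^+ 2) * sumX setT (fun i => w i * g i ^+ 2).
Proof.
move=> w0 sf sg; apply: quad_discr => s.
have sfg := summ_wM w0 sf sg.
rewrite -!sumXZ// -sumXB//; last exact: summZ.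
rewrite -sumXD; [|exact/summB/summZ|exact: summZ].
apply: sumX_ge0 => i.
rewrite (_ : _ + _ = w i * (f i - s * g i) ^+ 2); last by ring.
by rewrite mulr_ge0// sqr_ge0.
Qed.

(** Links the ordered limit that defines [heat] to unordered sums, for which Fubini is available. *)
Lemma cvg_series_sumX (f : nat -> R) : summ f -> series f @ \oo --> sumX setT f.
Proof.
have P (g : nat -> R) : (forall n, 0 <= g n) -> summ g -> series g @ \oo --> sumX setT g.
  move=> g0 sg; have := sumXE g0 sg; rewrite -nneseries_esumT; last first.
    by move=> n; rewrite lee_fin.
  move=> E.
  have : ((fun n => (\sum_(0 <= i < n) (g i)%:E)%E) @ \oo --> (sumX setT g)%:E)%E.
    by rewrite -E; apply: is_cvg_nneseries => n _ _; rewrite lee_fin.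
  by move/fine_cvg; apply: cvg_trans; apply: near_eq_cvg; near=> n; rewrite /= sumEFin.
move=> sf; have := sumX_posneg f => ->.
rewrite (_ : series f = series (fun n => Num.max (f n) 0) - series (fun n => Num.max (- f n) 0)).
  apply: cvgB; apply: P; try (by move=> n; rewrite le_max lexx orbT).
    exact: summ_pos.
  exact: summ_neg.
apply/funext => n; rewrite /series/= fctE -sumrB; apply: eq_bigr => i _.
by rewrite pos_sub_neg.
Unshelve. all: by end_near.
Qed.

Lemma limn_series_sumX (f : nat -> R) : summ f -> limn (series f) = sumX setT f.
Proof. by move/cvg_series_sumX/cvg_lim; exact. Qed.

Lemma cvg_series_summ (f : nat -> R) : (forall n, 0 <= f n) -> cvgn (series f) -> summ f.
Proof.
move=> f0 cf; apply: summ_ge0 => //.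
rewrite -nneseries_esumT; last by move=> n; rewrite lee_fin.
have -> : (\sum_(0 <= i <oo) (f i)%:E = (limn (series f))%:E)%E.
  rewrite -EFin_lim//; congr (limn _); apply/funext => n.
  by rewrite /= sumEFin.
exact: ltry.
Qed.

Lemma summ_exp_coeff (x : R) : summ (exp_coeff x).
Proof.
apply: (@summ_le _ _ _ (exp_coeff `|x|)).
  apply: cvg_series_summ => [n|]; last exact: is_cvg_series_exp_coeff.
  by rewrite exp_coeff_ge0.
by move=> n; rewrite /exp_coeff/= normrM normrX normfV normr_nat.
Qed.

Lemma sumX_exp_coeff (x : R) : sumX setT (exp_coeff x) = expR x.
Proof. by rewrite -limn_series_sumX//; exact: summ_exp_coeff. Qed.

Lemma summM {I J : countType} (f : I -> R) (g : J -> R) : summ f -> summ g ->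
  summ (fun p => f p.1 * g p.2).
Proof.
move=> sf sg; apply: summ_prod => [i|] /=; first exact: summZ.
apply: (@eq_summ _ _ (fun i => sumX setT (fun j => `|g j|) * `|f i|)).
  move=> i; rewrite mulrC -sumXZ; last exact: summ_norm.
  by apply: eq_sumX => j; rewrite normrM.
by apply: summZ; exact: summ_norm.
Qed.

(** The antidiagonals j + k = n partition the index set, and each is parametrised by j <= n. *)
Lemma esum_diag (a : nat * nat -> \bar R) : (forall p, 0 <= a p)%E ->
  (\esum_(p in setT) a p = \esum_(n in setT) \sum_(j < n.+1) a (j : nat, (n - j)%N))%E.
Proof.
move=> a0; pose J k := [set p : nat * nat | (p.1 + p.2)%N = k].
have -> : [set: nat * nat] = \bigcup_(k in setT) J k.
  by apply/seteqP; split=> // p _; exists (p.1 + p.2)%N.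
rewrite esum_bigcupT//; last first.
  by apply/trivIsetP => i j _ _ ij; rewrite -subset0 => p [/= pi pj]; move: ij; rewrite -pi -pj eqxx.
apply: eq_esum => n _.
rewrite (@reindex_esum _ _ _ `I_n.+1 (J n) (fun j => (j, (n - j)%N))).
  by rewrite esum_fset// -fsbig_ord.
split=> [j /= jn|i j _ _ [] //|[i j] /= <-].
  by rewrite /J/= subnKC.
by exists i => /=; [rewrite ltnS leq_addr|rewrite addKn].
Qed.

Lemma sumX_diag (f : nat * nat -> R) : summ f ->
  summ (fun n => \sum_(j < n.+1) f (j : nat, (n - j)%N)) /\
  sumX setT f = sumX setT (fun n => \sum_(j < n.+1) f (j : nat, (n - j)%N)).
Proof.
have P (g : nat * nat -> R) : (forall p, 0 <= g p) -> summ g ->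
    summ (fun n => \sum_(j < n.+1) g (j : nat, (n - j)%N)) /\
    sumX setT g = sumX setT (fun n => \sum_(j < n.+1) g (j : nat, (n - j)%N)).
  move=> g0 sg.
  have E : (\esum_(p in setT) (g p)%:E =
      \esum_(n in setT) (\sum_(j < n.+1) g (j : nat, (n - j)%N))%:E)%E.
    rewrite (@esum_diag (EFin \o g)); last by move=> p /=; rewrite lee_fin.
    by apply: eq_esum => n _; rewrite /= sumEFin.
  have h0 n : 0 <= \sum_(j < n.+1) g (j : nat, (n - j)%N) by apply: sumr_ge0.
  have s : summ (fun n => \sum_(j < n.+1) g (j : nat, (n - j)%N)).
    by apply: summ_ge0 => //; rewrite -E sumXE// ltry.
  by split=> //; apply: EFin_inj; rewrite -!sumXE.
have m0 (h : nat * nat -> R) x : 0 <= Num.max (h x) 0 by rewrite le_max lexx orbT.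
move=> sf; have [s1 e1] := P _ (m0 f) (summ_pos sf).
have [s2 e2] := P _ (m0 (fun x => - f x)) (summ_neg sf).
have E n : (\sum_(j < n.+1) Num.max (f (j : nat, (n - j)%N)) 0)
  - (\sum_(j < n.+1) Num.max (- f (j : nat, (n - j)%N)) 0)
  = \sum_(j < n.+1) f (j : nat, (n - j)%N).
  by rewrite -sumrB; apply: eq_bigr => j _; rewrite pos_sub_neg.
split; first by apply: eq_summ E _; exact: summB.
by rewrite sumX_posneg e1 e2 -sumXB//; apply: eq_sumX.
Qed.

Lemma exp_coeffD (x y : R) n :
  exp_coeff (x + y) n = \sum_(j < n.+1) exp_coeff x j * exp_coeff y (n - j)%N.
Proof.
rewrite /exp_coeff/= addrC exprDn mulr_suml; apply: eq_bigr => j _.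
have jn : (j <= n)%N by rewrite -ltnS.
have := bin_fact jn => /(congr1 (fun k => k%:R : R)); rewrite !natrM => E.
rewrite -E -[_ *+ _]mulr_natr.
have f0 k : (k`!)%:R != 0 :> R by rewrite pnatr_eq0 -lt0n fact_gt0.
have c0 : ('C(n, j))%:R != 0 :> R by rewrite pnatr_eq0 -lt0n bin_gt0.
by field; rewrite !f0 c0.
Qed.

Lemma summ_moment (a : nat -> R) (M C x : R) :
  (forall n, `|a n| <= M * C ^+ n) -> summ (fun n => exp_coeff x n * a n).
Proof.
move=> aM; apply: (@summ_le _ _ _ (fun n => M * exp_coeff (`|x| * C) n)).
  exact/summZ/summ_exp_coeff.
move=> n; rewrite /exp_coeff/= !normrM normrX normfV normr_nat exprMn.
rewrite (_ : M * _ = `|x| ^+ n / n`!%:R * (M * C ^+ n)); last by ring.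
by rewrite ler_wpM2l// divr_ge0// exprn_ge0.
Qed.

(* The Cauchy product [e^(xH) e^(yH) = e^((x+y)H)] at the level of moment sequences. *)
Lemma moment_expD (a : nat -> R) (M C x y : R) : 0 <= M -> 0 <= C ->
  (forall n, `|a n| <= M * C ^+ n) ->
  sumX setT (fun j => exp_coeff x j * sumX setT (fun k => exp_coeff y k * a (j + k)%N)) =
  sumX setT (fun n => exp_coeff (x + y) n * a n).
Proof.
move=> M0 C0 aM.
pose F (p : nat * nat) := exp_coeff x p.1 * exp_coeff y p.2 * a (p.1 + p.2)%N.
(* The bound M C^(j+k) splits as M C^j C^k, so F is dominated by a product of two exponential series
   and may be summed by rows or by antidiagonals. *)
have sF : summ F.
  apply: (@summ_le _ _ _ (fun p => M * (exp_coeff (`|x| * C) p.1 * exp_coeff (`|y| * C) p.2))).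
    by apply: summZ; apply: summM; exact: summ_exp_coeff.
  move=> [j k]; rewrite /F/exp_coeff/= !normrM !normrX !normfV !normr_nat !exprMn.
  rewrite (_ : M * _ = `|x| ^+ j / j`!%:R * (`|y| ^+ k / k`!%:R) * (M * C ^+ (j + k))); last by rewrite exprD; ring.
  by rewrite ler_wpM2l// mulr_ge0// divr_ge0// exprn_ge0.
have [_ e2] := sumX_diag sF; transitivity (sumX setT F).
  rewrite sumX_prod//; apply: eq_sumX => j; rewrite -sumXZ.
    by apply: eq_sumX => k; rewrite mulrA.
  apply: (@summ_moment _ (M * C ^+ j) C) => k.
  by rewrite -mulrA -exprD.
rewrite e2; apply: eq_sumX => n; rewrite exp_coeffD mulr_suml; apply: eq_bigr => j _.
by rewrite /F/= subnKC// -ltnS.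
Qed.

End CauchyProduct.

Lemma ler_sumX_term {R : realType} {I : countType} (f : I -> R) i :
  (forall i, 0 <= f i) -> summ f -> f i <= sumX setT f.
Proof.
move=> f0 sf; pose g j := if j == i then f j else 0.
have [sg eg] : summ g /\ sumX setT g = g i.
  by apply: sumX_single => j /negPf; rewrite /g => ->.
have -> : f i = g i by rewrite /g eqxx.
rewrite -eg; apply: le_sumX => // j.
by rewrite /g; case: ifP.
Qed.

(** * Energy form and moments of the Laplacian *)

Section LaplacianMoments.
Context {R : realType} {X : countType}.
Variables (b : X -> X -> R) (m : X -> R) (C : R).
Hypotheses (m_gt0 : forall x, 0 < m x) (b_ge0 : forall x y, 0 <= b x y)
  (b_sym : forall x y, b x y = b y x) (b_summ : forall x, summ (b x))
  (C_ge0 : 0 <= C) (deg_le : forall x, sumX setT (b x) <= C * m x).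

Definition ip (f g : X -> R) := sumX setT (fun x => m x * (f x * g x)).
Definition l2 (f : X -> R) := summ (fun x => m x * f x ^+ 2).
Definition nsq (f : X -> R) := sumX setT (fun x => m x * f x ^+ 2).
Definition grad (f : X -> R) (p : X * X) := f p.1 - f p.2.
(** The factor 1/2 compensates for the sum over ordered pairs, which meets every edge twice. *)
Definition energy (f g : X -> R) :=
  sumX setT (fun p => b p.1 p.2 / 2 * (grad f p * grad g p)).
Local Notation H := (Lap b m).

Let m_ge0 x : 0 <= m x. Proof. exact: ltW. Qed.
Let b2_ge0 (p : X * X) : 0 <= b p.1 p.2 / 2. Proof. by rewrite divr_ge0. Qed.

Lemma nsq_ge0 f : 0 <= nsq f.
Proof. by apply: sumX_ge0 => x; rewrite mulr_ge0// sqr_ge0. Qed.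

Lemma ipC f g : ip f g = ip g f.
Proof. by apply: eq_sumX => x; rewrite (mulrC (f x)). Qed.

Lemma ipff f : ip f f = nsq f.
Proof. by apply: eq_sumX => x; rewrite expr2. Qed.

Lemma energyC f g : energy f g = energy g f.
Proof. by apply: eq_sumX => p; rewrite (mulrC (grad f p)). Qed.

Lemma energy_ge0 f : 0 <= energy f f.
Proof. by apply: sumX_ge0 => p; rewrite mulr_ge0// -expr2 sqr_ge0. Qed.

Lemma l2D f g : l2 f -> l2 g -> l2 (fun x => f x + g x).
Proof.
move=> lf lg; apply: (@summ_le _ _ _ (fun x => 2 * (m x * f x ^+ 2 + m x * g x ^+ 2))).
  exact/summZ/summD.
move=> x; rewrite ger0_norm; last by rewrite mulr_ge0// sqr_ge0.
rewrite -mulrDr [leRHS]mulrCA ler_wpM2l//.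
by have := sqr_ge0 (f x - g x); nra.
Qed.

Lemma l2Z c f : l2 f -> l2 (fun x => c * f x).
Proof. by move=> /(summZ (c ^+ 2)); apply: eq_summ => x; ring. Qed.

Lemma nsqZ c f : l2 f -> nsq (fun x => c * f x) = c ^+ 2 * nsq f.
Proof. by move=> lf; rewrite -sumXZ//; apply: eq_sumX => x; ring. Qed.

Lemma l2_le f g : l2 g -> (forall x, `|f x| <= `|g x|) -> l2 f.
Proof.
move=> lg fg; apply: summ_le lg _ => x.
rewrite ger0_norm; last by rewrite mulr_ge0// sqr_ge0.
rewrite ler_wpM2l// -(real_normK (num_real (f x))) -(real_normK (num_real (g x))).
by rewrite ler_sqr ?nnegrE.
Qed.

Lemma summ_ip f g : l2 f -> l2 g -> summ (fun x => m x * (f x * g x)).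
Proof. exact: summ_wM. Qed.

Lemma ip_CS f g : l2 f -> l2 g -> ip f g ^+ 2 <= nsq f * nsq g.
Proof. exact: sumX_CS. Qed.

(** Summing over the second coordinate first leaves f(x)^2 times the total edge weight at x, which
    is at most C m(x). *)
Lemma summ_b1 f : l2 f -> summ (fun p : X * X => b p.1 p.2 * f p.1 ^+ 2) /\
  sumX setT (fun p : X * X => b p.1 p.2 * f p.1 ^+ 2) <= C * nsq f.
Proof.
move=> lf; pose F (p : X * X) := b p.1 p.2 * f p.1 ^+ 2.
have E x : sumX setT (fun y => F (x, y)) = f x ^+ 2 * sumX setT (b x).
  by rewrite -sumXZ//; apply: eq_sumX => y; rewrite mulrC.
have F0 p : 0 <= F p by rewrite mulr_ge0// sqr_ge0.
have le x : f x ^+ 2 * sumX setT (b x) <= C * (m x * f x ^+ 2).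
  by rewrite mulrC mulrA ler_wpM2r// sqr_ge0.
have s2 : summ (fun x => sumX setT (fun y => F (x, y))).
  apply: summ_le (summZ C lf) _ => x.
  by rewrite ger0_norm; [rewrite E|exact: sumX_ge0].
have sF : summ F.
  apply: summ_prod => [x|].
    by apply: eq_summ (summZ (f x ^+ 2) (b_summ x)) => y; rewrite mulrC.
  by apply: eq_summ s2 => x; apply: eq_sumX => y; rewrite ger0_norm.
split=> //; rewrite sumX_prod// -sumXZ//; apply: le_sumX => //; first exact: summZ.
by move=> x; rewrite E.
Qed.

Lemma summ_b2 f : l2 f -> summ (fun p : X * X => b p.1 p.2 * f p.2 ^+ 2) /\
  sumX setT (fun p : X * X => b p.1 p.2 * f p.2 ^+ 2) <= C * nsq f.
Proof.
move=> lf; have [s1 s2] := summ_b1 lf.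
have E (p : X * X) : b p.2 p.1 * f p.2 ^+ 2 = b p.1 p.2 * f p.2 ^+ 2.
  by rewrite b_sym.
split; first exact: eq_summ E (summ_swap s1).
by rewrite -(eq_sumX _ E) -(sumX_swap (fun p : X * X => b p.1 p.2 * f p.1 ^+ 2)).
Qed.

Lemma summ_grad f : l2 f -> summ (fun p => b p.1 p.2 / 2 * grad f p ^+ 2) /\
  energy f f <= 2 * C * nsq f.
Proof.
move=> lf; have [s1 e1] := summ_b1 lf; have [s2 e2] := summ_b2 lf.
have le (p : X * X) : b p.1 p.2 / 2 * grad f p ^+ 2 <= b p.1 p.2 * f p.1 ^+ 2 + b p.1 p.2 * f p.2 ^+ 2.
  rewrite -mulrDr -mulrA ler_wpM2l// /grad.
  by have := sqr_ge0 (f p.1 + f p.2); nra.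
have s : summ (fun p => b p.1 p.2 / 2 * grad f p ^+ 2).
  apply: summ_le (summD s1 s2) _ => p.
  by rewrite ger0_norm// mulr_ge0// sqr_ge0.
split=> //.
have -> : energy f f = sumX setT (fun p => b p.1 p.2 / 2 * grad f p ^+ 2).
  by apply: eq_sumX => p; rewrite expr2.
apply: le_trans (le_sumX s (summD s1 s2) le) _.
by rewrite sumXD//; lra.
Qed.

Lemma energyE f : energy f f = sumX setT (fun p => b p.1 p.2 / 2 * grad f p ^+ 2).
Proof. by apply: eq_sumX => p; rewrite expr2. Qed.

Lemma energy_CS f g : l2 f -> l2 g -> energy f g ^+ 2 <= energy f f * energy g g.
Proof.
move=> lf lg; rewrite !energyE.
exact: (sumX_CS b2_ge0 (summ_grad lf).1 (summ_grad lg).1).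
Qed.

Lemma summ_grad_section f x : l2 f -> summ (fun y => b x y * (f x - f y) ^+ 2).
Proof.
move=> lf; apply: eq_summ (summ_section x (summZ 2 (summ_grad lf).1)) => y.
by rewrite /grad/=; field.
Qed.

(** Cauchy-Schwarz with weight [b x] against the constant 1, whose weighted square is summable by
    [b_summ]. *)
Lemma summ_Lap f x : l2 f -> summ (fun y => b x y * (f x - f y)).
Proof.
move=> lf; have := @summ_wM _ _ (b x) (fun y => f x - f y) (fun=> 1) (b_ge0 x).
move=> /(_ (summ_grad_section x lf)) s.
apply: eq_summ (s _) => [y|]; first by rewrite mulr1.
by apply: eq_summ (b_summ x) => y; rewrite expr1n mulr1.
Qed.

(** Green's formula: the left side is a sum over ordered pairs, and averaging it with its image
    under the swap turns g(x) into (g(x) - g(y)) / 2. *)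
Lemma ip_Lap f g : l2 f -> l2 g -> ip (H f) g = energy f g.
Proof.
move=> lf lg; pose F (p : X * X) := b p.1 p.2 * (grad f p * g p.1).
have sF : summ F.
  apply: summ_wM => [p //||]; last exact: (summ_b1 lg).1.
  by apply: eq_summ (summZ 2 (summ_grad lf).1) => p; field.
have E1 : ip (H f) g = sumX setT F.
  rewrite sumX_prod//; apply: eq_sumX => x.
  rewrite /Lap -mulrA mulrA divff ?mul1r ?gt_eqF// mulrC -sumXZ; last exact: summ_Lap.
  by apply: eq_sumX => y; rewrite /F/grad/=; ring.
have E2 := sumX_swap F.
have sF' := summ_swap sF.
suff : energy f g = 2^-1 * (sumX setT F + sumX setT (fun p => F (p.2, p.1))).
  by rewrite -E2 E1 => ->; field.
rewrite -sumXD// -sumXZ; last exact: summD.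
by apply: eq_sumX => p; rewrite /F/grad/= (b_sym p.2 p.1); field.
Qed.

(** Cauchy-Schwarz against 1 bounds m(x) (Hf(x))^2 by C times the sum of b(x,y) (f(x) - f(y))^2 over
    y. Summing over x gives |Hf|^2 <= 2C Q(f), and Q(f) <= 2C |f|^2. *)
Lemma l2_Lap f : l2 f -> l2 (H f) /\ nsq (H f) <= (2 * C) ^+ 2 * nsq f.
Proof.
move=> lf; pose F (p : X * X) := b p.1 p.2 * grad f p ^+ 2.
have sF : summ F.
  by apply: eq_summ (summZ 2 (summ_grad lf).1) => p; rewrite /F; field.
have sG := summ_sumX sF.
have F0 p : 0 <= F p by rewrite mulr_ge0// sqr_ge0.
have le x : m x * H f x ^+ 2 <= C * sumX setT (fun y => F (x, y)).
  set S := sumX _ _.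
  have h : (m x * H f x) ^+ 2 <= S * sumX setT (b x).
    have -> : m x * H f x = sumX setT (fun y => b x y * ((f x - f y) * 1)).
      rewrite /Lap mulrA divff ?mul1r ?gt_eqF//.
      by apply: eq_sumX => y; rewrite mulr1.
    have s1 : (fun y => b x y * 1 ^+ 2) = b x by apply/funext => y; rewrite expr1n mulr1.
    have := @sumX_CS _ _ (b x) (fun y => f x - f y) (fun=> 1) (b_ge0 x) (summ_grad_section x lf).
    by rewrite /= s1; apply.
  have S0 : 0 <= S by apply: sumX_ge0.
  have h2 : (m x * H f x) ^+ 2 <= S * (C * m x).
    by apply: le_trans h _; rewrite ler_wpM2l// deg_le.
  rewrite -(ler_pM2l (m_gt0 x)); rewrite (_ : m x * (C * S) = S * (C * m x)); last by ring.
  by rewrite (_ : m x * (m x * _) = (m x * H f x) ^+ 2)//; ring.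
have l : l2 (H f).
  apply: summ_le (summZ C sG) _ => x.
  by rewrite ger0_norm// mulr_ge0// sqr_ge0.
split=> //; apply: (@le_trans _ _ (C * sumX setT (fun x => sumX setT (fun y => F (x, y))))).
  rewrite -sumXZ//; apply: le_sumX => //; exact: summZ.
rewrite -sumX_prod//.
have -> : sumX setT F = 2 * energy f f.
  rewrite energyE -sumXZ; last exact: (summ_grad lf).1.
  by apply: eq_sumX => p; rewrite /F; field.
have := (summ_grad lf).2 => h.
have := ler_wpM2l C_ge0 h; rewrite (_ : (2 * C) ^+ 2 * nsq f = 2 * (C * (2 * C * nsq f))); last by ring.
lra.
Qed.

Lemma iter_Lap_l2 n f : l2 f -> l2 (iter n H f) /\ nsq (iter n H f) <= nsq f * ((2 * C) ^+ 2) ^+ n.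
Proof.
move=> lf; elim: n => [|n [ln en]]; first by rewrite expr0 mulr1.
have [l e] := l2_Lap ln; split=> //=; apply: le_trans e _.
by rewrite [_ ^+ n.+1]exprS [leRHS]mulrCA ler_wpM2l// sqr_ge0.
Qed.

Lemma ip_Lapr f g : l2 f -> l2 g -> ip f (H g) = ip (H f) g.
Proof. by move=> lf lg; rewrite ipC !ip_Lap// energyC. Qed.

Lemma ip_iter n f g : l2 f -> l2 g -> ip f (iter n H g) = ip (iter n H f) g.
Proof.
move=> lf lg; elim: n f lf => //= n IH f lf.
rewrite ip_Lapr//; last exact: (iter_Lap_l2 _ lg).1.
by rewrite IH -?iterSr//; exact: (l2_Lap lf).1.
Qed.

Lemma moment_le f n : l2 f -> `|ip f (iter n H f)| <= nsq f * (2 * C) ^+ n.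
Proof.
move=> lf; have [l e] := iter_Lap_l2 n lf.
have C2 : 0 <= nsq f * (2 * C) ^+ n by rewrite mulr_ge0 ?nsq_ge0// exprn_ge0// mulr_ge0.
rewrite -(@ler_sqr _ `|_|) ?nnegrE// real_normK ?num_real//.
apply: le_trans (ip_CS lf l) _; rewrite exprMn expr2 -mulrA ler_wpM2l ?nsq_ge0//.
by rewrite exprAC.
Qed.

(** * Log-convexity of the moments of the Laplacian *)

Section Moments.
Variable f : X -> R.
Hypothesis lf : l2 f.
Let al n := ip f (iter n H f).

Lemma moment_even j : al (j + j) = nsq (iter j H f).
Proof.
rewrite /al iterD ip_iter ?ipff//; exact: (iter_Lap_l2 _ lf).1.
Qed.

Lemma moment_odd j : al (j + j.+1) = energy (iter j H f) (iter j H f).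
Proof.
have l := (iter_Lap_l2 j lf).1.
rewrite /al iterD ip_iter//=; last exact: (l2_Lap l).1.
by rewrite ip_Lapr// ip_Lap.
Qed.

Lemma moment_ge0 n : 0 <= al n.
Proof.
rewrite -(odd_double_half n) -addnn; case: (odd n).
  by rewrite add1n -addnS moment_odd energy_ge0.
by rewrite add0n moment_even nsq_ge0.
Qed.

(** Even moments are squared norms and odd ones are energies of iterates. So this is Cauchy-Schwarz
    for the inner product when n is even and for the energy form when n is odd. *)
Lemma moment_logconvex n : al n.+1 ^+ 2 <= al n * al n.+2.
Proof.
rewrite -(odd_double_half n) -addnn; set j := (n./2).
have l := (iter_Lap_l2 j lf).1; have l1 := (iter_Lap_l2 j.+1 lf).1.
case: (odd n).
  rewrite !add1n -[(j + j).+1]addnS moment_odd -addSn moment_even.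
  rewrite -[(j.+1 + j.+1).+1]addnS moment_odd.
  have -> : nsq (iter j.+1 H f) = energy (iter j H f) (iter j.+1 H f).
    by rewrite -ipff -ip_Lap.
  exact: energy_CS.
rewrite !add0n moment_even -[(j + j).+1]addnS moment_odd -addSn moment_even.
rewrite -ip_Lap// ipC; exact: ip_CS.
Qed.

(** By log-convexity the ratios of successive moments do not decrease, and the hypothesis bounds the
    first one below by [lam]. The induction avoids division because moments may vanish; after a
    vanishing moment the next one vanishes too. *)
Lemma moment_growth lam n : 0 <= lam -> lam * nsq f <= energy f f ->
  lam ^+ n * nsq f <= al n.
Proof.
move=> lam0 h0.
have step k : lam * al k <= al k.+1.
  elim: k => [|k IH].
    by have := moment_even 0; have := moment_odd 0; rewrite addn0 add0n /= => -> ->.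
  have := moment_logconvex k; have := moment_ge0 k; have := moment_ge0 k.+1; have := moment_ge0 k.+2.
  move=> a2 a1 a0 lc.
  have [a00|a0p] := eqVneq (al k) 0.
    have : al k.+1 = 0 by apply/eqP; rewrite -sqrf_eq0 eq_le sqr_ge0 andbT (le_trans lc)// a00 mul0r.
    by move=> ->; rewrite mulr0.
  have {}a0p : 0 < al k by rewrite lt_def a0p.
  rewrite -(ler_pM2l a0p); apply: le_trans lc.
  by rewrite mulrA [al k * lam]mulrC expr2 ler_wpM2r.
elim: n => [|n IH]; first by rewrite expr0 mul1r -[al 0]/(al (0 + 0)) moment_even.
by apply: le_trans (step n); rewrite exprS -mulrA ler_wpM2l.
Qed.

End Moments.

End LaplacianMoments.

(** * Heat semigroup *)

Section HeatSemigroup.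
Context {R : realType} {X : countType}.
Variables (b : X -> X -> R) (m : X -> R) (C : R).
Hypotheses (m_gt0 : forall x, 0 < m x) (b_ge0 : forall x y, 0 <= b x y)
  (b_sym : forall x y, b x y = b y x) (b_summ : forall x, summ (b x))
  (C_ge0 : 0 <= C) (deg_le : forall x, sumX setT (b x) <= C * m x).
Local Notation H := (Lap b m).
Local Notation l2 := (l2 m).
Local Notation nsq := (nsq m).
Local Notation ip := (ip m).
Local Notation energy := (energy b).
Let m_ge0 x : 0 <= m x. Proof. exact: ltW. Qed.
Let iter_l2 n f : l2 f -> l2 (iter n H f).
Proof. by move=> lf; exact: (iter_Lap_l2 m_gt0 b_ge0 b_sym b_summ C_ge0 deg_le n lf).1. Qed.
Let iter_nsq n f : l2 f -> nsq (iter n H f) <= nsq f * ((2 * C) ^+ 2) ^+ n.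
Proof. by move=> lf; exact: (iter_Lap_l2 m_gt0 b_ge0 b_sym b_summ C_ge0 deg_le n lf).2. Qed.
Let C2_ge0 : 0 <= 2 * C. Proof. by rewrite mulr_ge0. Qed.

Section Orbit.
Variable phi : X -> R.
Hypothesis lphi : l2 phi.
Let h k := iter k H phi.
Let a n := ip phi (iter n H phi).

(** Evaluation at x is bounded on l2, since m(x) h(x)^2 is one term of |h|^2. This makes the
    pointwise heat series absolutely convergent. *)
Lemma iter_Lap_le x n : `|h n x| <= Num.sqrt (nsq phi / m x) * (2 * C) ^+ n.
Proof.
rewrite -ler_sqr ?nnegrE//; last by rewrite mulr_ge0 ?sqrtr_ge0// exprn_ge0.
rewrite real_normK ?num_real// exprMn sqr_sqrtr; last by rewrite divr_ge0// nsq_ge0.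
rewrite -(ler_pM2l (m_gt0 x)).
apply: (@le_trans _ _ (nsq (h n))).
  apply: (@ler_sumX_term _ _ (fun x => m x * h n x ^+ 2)); last exact: iter_l2.
  by move=> y; rewrite mulr_ge0// sqr_ge0.
apply: le_trans (iter_nsq n lphi) _.
rewrite exprAC le_eqVlt; apply/orP; left; apply/eqP; field.
by rewrite gt_eqF.
Qed.

Lemma summ_heat t x : summ (fun k => exp_coeff t k * h k x).
Proof. apply: summ_moment => n; exact: iter_Lap_le. Qed.

Lemma heatE t x : heat b m t phi x = sumX setT (fun k => exp_coeff (- t) k * h k x).
Proof. by rewrite -limn_series_sumX//; exact: summ_heat. Qed.

Lemma summ_exp_nsq t : summ (fun k => exp_coeff t k * nsq (h k)).
Proof.
apply: (@summ_moment _ _ (nsq phi) ((2 * C) ^+ 2)) => n.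
by rewrite ger0_norm ?nsq_ge0//; exact: iter_nsq.
Qed.

(** With w_k = |t|^k / k!, Cauchy-Schwarz in k gives |u_t(x)|^2 <= e^|t| sum_k w_k |H^k phi(x)|^2;
    the right side, weighted by m, is summed over x by Fubini. *)
Lemma heat_l2 t : l2 (heat b m t phi).
Proof.
pose w := exp_coeff `|- t|.
have w0 k : 0 <= w k by rewrite exp_coeff_ge0.
pose F (p : nat * X) := w p.1 * (m p.2 * h p.1 p.2 ^+ 2).
have F0 p : 0 <= F p by rewrite mulr_ge0// mulr_ge0// sqr_ge0.
have sF : summ F.
  apply: summ_prod => [k|]; first exact: (summZ (w k) (iter_l2 k lphi)).
  apply: eq_summ (summ_exp_nsq `|- t|) => k.
  rewrite -sumXZ; last exact: iter_l2.
  by apply: eq_sumX => x; rewrite [RHS]ger0_norm.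
have s := summ_sumX (summ_swap sF).
apply: summ_le (summZ (expR `|- t|) s) _ => x /=.
rewrite ger0_norm; last by rewrite mulr_ge0// sqr_ge0.
have sx : summ (fun k => w k * `|h k x| ^+ 2).
  apply: eq_summ (summZ (m x)^-1 (summ_section x (summ_swap sF))) => k.
  rewrite /F/= real_normK ?num_real//; field; by rewrite gt_eqF.
have s1 : summ (fun k => w k * 1 ^+ 2).
  by apply: eq_summ (summ_exp_coeff `|- t|) => k; rewrite expr1n mulr1.
have := sumX_CS w0 s1 sx.
have -> : (fun k => w k * 1 ^+ 2) = w by apply/funext => k; rewrite expr1n mulr1.
rewrite sumX_exp_coeff => CS.
have -> : sumX setT (fun k => F (k, x)) = m x * sumX setT (fun k => w k * `|h k x| ^+ 2).
  rewrite -sumXZ//; apply: eq_sumX => k; rewrite /F/= real_normK ?num_real//; ring.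
rewrite [leRHS]mulrCA ler_wpM2l//; apply: le_trans CS.
have wh k : `|exp_coeff (- t) k * h k x| = w k * (1 * `|h k x|).
  by rewrite /w/exp_coeff/= !normrM normrX normfV normr_nat mul1r.
have sw := summ_norm (summ_heat (- t) x).
rewrite heatE -[leLHS]real_normK ?num_real// ler_sqr ?nnegrE//; last first.
  by apply: sumX_ge0 => k; rewrite mulr_ge0// mul1r.
apply: le_trans (ler_norm_sumX (summ_heat (- t) x)) _.
by rewrite (eq_sumX _ wh).
Qed.

Lemma ip_heat t psi : l2 psi ->
  ip (heat b m t phi) psi = sumX setT (fun k => exp_coeff (- t) k * ip (h k) psi).
Proof.
move=> lpsi; pose F (p : nat * X) := exp_coeff (- t) p.1 * (m p.2 * (h p.1 p.2 * psi p.2)).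
have sF : summ F.
  apply: summ_prod => [k|]; first exact: (summZ (exp_coeff (- t) k) (summ_ip m_gt0 (iter_l2 k lphi) lpsi)).
  (* The dominating series comes from |h psi| <= h^2 + psi^2. *)
  have s1 := summD (summ_exp_nsq `|- t|) (summZ (nsq psi) (summ_exp_coeff `|- t|)).
  apply: summ_le s1 _ => k; rewrite ger0_norm; last exact: sumX_ge0.
  rewrite [_ * exp_coeff _ _]mulrC -mulrDr -sumXD//; last exact: iter_l2.
  have sD := summD (iter_l2 k lphi) lpsi.
  rewrite -sumXZ//; apply: le_sumX.
  - exact: (summ_norm (summZ (exp_coeff (- t) k) (summ_ip m_gt0 (iter_l2 k lphi) lpsi))).
  - exact: summZ.
  move=> x; rewrite /F/= normrM.
  have -> : `|exp_coeff (- t) k| = exp_coeff `|- t| k.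
    by rewrite /exp_coeff/= normrM normrX normfV normr_nat.
  rewrite ler_wpM2l ?exp_coeff_ge0// normrM ger0_norm// -mulrDr ler_wpM2l//.
  rewrite ler_norml; apply/andP; split;
    have := sqr_ge0 (h k x + psi x); have := sqr_ge0 (h k x - psi x);
    have := sqr_ge0 (h k x); have := sqr_ge0 (psi x); nra.
transitivity (sumX setT (fun x => sumX setT (fun k => F (k, x)))).
  apply: eq_sumX => x; rewrite heatE [_ * psi x]mulrC mulrA -sumXZ; last exact: summ_heat.
  by apply: eq_sumX => k; rewrite /F/=; ring.
rewrite -(@exchange_sumX _ _ _ (fun k x => F (k, x))); last by apply: eq_summ sF => -[].
apply: eq_sumX => k; exact: (sumXZ (exp_coeff (- t) k) (summ_ip m_gt0 (iter_l2 k lphi) lpsi)).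
Qed.

Let aM n : `|a n| <= nsq phi * (2 * C) ^+ n.
Proof. exact: moment_le. Qed.

(** Both factors u_t are expanded in powers of H, which symmetry gathers on one copy of phi. The
    Cauchy product then merges the two exponentials into one with parameter -2t. *)
Lemma heat_moment t n :
  ip (heat b m t phi) (iter n H (heat b m t phi)) =
  sumX setT (fun k => exp_coeff (- t - t) k * a (n + k)%N).
Proof.
have lu := heat_l2 t; set u := heat b m t phi in lu *.
have iph k : ip (h k) (iter n H u) = sumX setT (fun j => exp_coeff (- t) j * a (n + k + j)%N).
  rewrite (ip_iter m_gt0 b_ge0 b_sym b_summ C_ge0 deg_le)//; last exact: iter_l2.
  rewrite -iterD ipC ip_heat; last exact: iter_l2.
  apply: eq_sumX => j; congr (_ * _).
  rewrite ipC -(ip_iter m_gt0 b_ge0 b_sym b_summ C_ge0 deg_le)//; last exact: iter_l2.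
  by rewrite /h /a -iterD.
rewrite {1}/u ip_heat; last exact: iter_l2.
rewrite -(@moment_expD _ (fun k => a (n + k)%N) (nsq phi * (2 * C) ^+ n) (2 * C))//.
- by apply: eq_sumX => k; rewrite iph; congr (_ * _); apply: eq_sumX => j; rewrite addnA.
- by rewrite mulr_ge0 ?nsq_ge0// exprn_ge0.
- by move=> k; rewrite -mulrA -exprD.
Qed.

Lemma heat0 : heat b m 0 phi = phi.
Proof.
apply/funext => x; rewrite heatE oppr0.
have [k k0|_ ->] := @sumX_single _ _ 0%N (fun k => exp_coeff (0 : R) k * h k x).
  by rewrite /exp_coeff/= expr0n (negPf k0) !mul0r.
by rewrite /exp_coeff/= expr0 divr1 mul1r.
Qed.

Lemma heat_growth t s lam : 0 <= s -> 0 <= lam ->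
  lam * nsq (heat b m t phi) <= energy (heat b m t phi) (heat b m t phi) ->
  expR (lam * (2 * s)) * nsq (heat b m t phi) <= nsq (heat b m (t - s) phi).
Proof.
move=> s0 lam0; have lu := heat_l2 t; have um := heat_moment t.
set u := heat b m t phi in lu um * => h0.
have -> : nsq (heat b m (t - s) phi) =
    sumX setT (fun n => exp_coeff (2 * s) n * ip u (iter n H u)).
  (* Both sides equal the moment series of phi with parameter 2s - 2t = -2(t - s): one by the Cauchy
     product, the other by [heat_moment] at t - s. *)
  have -> : sumX setT (fun n => exp_coeff (2 * s) n * ip u (iter n H u)) =
    sumX setT (fun n => exp_coeff (2 * s + (- t - t)) n * a n).
    rewrite -(@moment_expD _ a (nsq phi) (2 * C)) ?nsq_ge0//.
    by apply: eq_sumX => n; rewrite um.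
  have := heat_moment (t - s) 0; rewrite /= ipff => ->.
  by congr sumX; apply/funext => n; congr (exp_coeff _ _ * _); ring.
rewrite -sumX_exp_coeff mulrC -sumXZ; last exact: summ_exp_coeff.
have se : summ (fun n => exp_coeff (2 * s) n * ip u (iter n H u)).
  by apply: summ_moment => n; exact: (moment_le m_gt0 b_ge0 b_sym b_summ C_ge0 deg_le n lu).
apply: le_sumX => // [|n]; first exact/summZ/summ_exp_coeff.
have := moment_growth m_gt0 b_ge0 b_sym b_summ C_ge0 deg_le lu n lam0 h0 => g.
have e0 : 0 <= exp_coeff (2 * s) n by rewrite exp_coeff_ge0// mulr_ge0.
apply: le_trans (ler_wpM2l e0 g).
by rewrite /exp_coeff/= exprMn le_eqVlt; apply/orP; left; apply/eqP; ring.
Qed.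

Lemma heat_decr t s : s <= t -> nsq (heat b m t phi) <= nsq (heat b m s phi).
Proof.
move=> st; have := @heat_growth t (t - s) 0; rewrite subr_ge0 st lexx !mul0r expR0 mul1r.
by rewrite energy_ge0// opprB addrC subrK; apply.
Qed.

Lemma heat_decay t lam : 0 <= t -> 0 <= lam ->
  lam * nsq (heat b m t phi) <= energy (heat b m t phi) (heat b m t phi) ->
  expR (lam * (2 * t)) * nsq (heat b m t phi) <= nsq phi.
Proof. by move=> t0 l0 /(heat_growth t0 l0); rewrite subrr heat0. Qed.

End Orbit.
End HeatSemigroup.

(** * Length metric and shortest-path forest *)

Section PathMetric.
Context {R : realType} {X : countType}.
Variables (b : X -> X -> R) (B : R).
Hypotheses (b_ge0 : forall x y, 0 <= b x y) (b_sym : forall x y, b x y = b y x)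
  (b_summ : forall x, summ (b x)) (B_gt0 : 0 < B)
  (b_le : forall x, sumX setT (b x) <= B).

Lemma edge_le x y : b x y <= B.
Proof. exact: le_trans (ler_sumX_term _ (b_ge0 x) (b_summ x)) (b_le x). Qed.

Lemma plen_ge0 x ps : 0 <= plen b x ps.
Proof. by elim: ps x => //= y ps IH x; rewrite addr_ge0// invr_ge0. Qed.

(** Edge weights are at most B, so every edge has length at least 1/B. *)
Lemma size_le_plen x ps : is_path b x ps -> (size ps)%:R <= B * plen b x ps.
Proof.
elim: ps x => [|y ps IH] x /=; first by rewrite mulr0.
move=> /andP[bxy /IH h]; rewrite mulrDr -natr1 addrC lerD//.
by rewrite -(ler_pM2r bxy) mul1r -mulrA mulVf ?mulr1 ?gt_eqF// edge_le.
Qed.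

Lemma plen_rcons x ps y : plen b x (rcons ps y) = plen b x ps + (b (last x ps) y)^-1.
Proof. by elim: ps x => [|z ps IH] x /=; rewrite ?addr0 ?add0r// IH addrA. Qed.

Lemma path_rev x ps : is_path b x ps ->
  exists qs, [/\ is_path b (last x ps) qs, last (last x ps) qs = x &
    plen b (last x ps) qs = plen b x ps].
Proof.
elim: ps x => [|y ps IH] x /=; first by exists [::].
move=> /andP[bxy /IH[qs [p1 l1 e1]]]; exists (rcons qs x); split.
- by rewrite /is_path rcons_path [path _ _ _]p1 l1 b_sym.
- by rewrite last_rcons.
- by rewrite plen_rcons e1 l1 addrC b_sym.
Qed.

Lemma dL_le_plen x ps : is_path b x ps -> dL b x (last x ps) <= plen b x ps.
Proof.
move=> p; rewrite /dL; case: eqP => _; first exact: plen_ge0.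
apply: ge_inf; last by exists ps.
by exists 0 => _ [qs [_ _ ->]]; exact: plen_ge0.
Qed.

Hypothesis b_conn : connected_graph b.

Lemma dL_lt_path x y r : 0 < r -> dL b x y < r ->
  exists ps, [/\ is_path b x ps, last x ps = y & plen b x ps < r].
Proof.
move=> r0; rewrite /dL; case: eqP => [-> _|_]; first by exists [::].
move/inf_lt => [].
  have [ps /andP[p /eqP l]] := b_conn x y.
  by exists (plen b x ps), ps.
by move=> _ [ps [p l ->]] h; exists ps.
Qed.

Lemma path_edge_ge x ps L : 0 < L -> is_path b x ps -> plen b x ps <= L ->
  path (fun u v => L^-1 <= b u v) x ps.
Proof.
move=> L0; elim: ps x => [//|y ps IH] x /= /andP[bxy p] h.
have bi : 0 <= (b x y)^-1 by rewrite invr_ge0.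
have h1 : (b x y)^-1 <= L by have := plen_ge0 y ps; lra.
rewrite IH//; last by lra.
by rewrite andbT -[leRHS]invrK lef_pV2 ?posrE// invr_gt0.
Qed.

(** More than B / c such neighbours would carry a total weight above B. *)
Lemma finite_neighbours x c : 0 < c -> finite_set [set y | c <= b x y].
Proof.
move=> c0; apply: contrapT => inf.
have [n hn] : exists n : nat, B / c < n%:R.
  by exists (Num.truncn (B / c)).+1; rewrite truncnS_gt.
have [F FA nF] := infinite_set_fset n inf.
have : ((n%:R * c)%:E <= (sumX setT (b x))%:E)%E.
  rewrite -sumXE//; apply: esum_ge; exists [set` F].
    by split=> //; exact: finite_fset.
  rewrite fsbig_finite//= set_fsetK sumEFin lee_fin.
  apply: (@le_trans _ _ (\sum_(i <- F) c)).
    rewrite big_const_seq count_predT iter_addr addr0 -[leRHS]mulr_natl.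
    by apply: ler_wpM2r; [exact: ltW|rewrite ler_nat].
  by rewrite big_seq [leRHS]big_seq; apply: ler_sum => i iF; exact: FA.
rewrite lee_fin => h; have := le_trans h (b_le x).
by rewrite -ler_pdivlMr// leNgt hn.
Qed.

(** Length at most L bounds the number of edges by B L and each edge weight below by 1/L, so there
    are finitely many choices at each of boundedly many steps. *)
Lemma finite_paths L x : 0 < L ->
  finite_set [set ps | is_path b x ps /\ plen b x ps <= L].
Proof.
move=> L0; pose P k x := [set ps : seq X | size ps = k /\ path (fun u v => L^-1 <= b u v) x ps].
have fP k : forall x, finite_set (P k x).
  elim: k => [|k IH] {}x.
    by apply: sub_finite_set (finite_set1 [::]) => ps [/size0nil ->].
  have f : finite_set (\bigcup_(z in [set z | L^-1 <= b x z]) (cons z @` P k z)).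
    apply: bigcup_finite => [|z _]; first by apply: finite_neighbours; rewrite invr_gt0.
    exact: finite_image.
  apply: sub_finite_set f => -[|z ps] [] //= [sz] /andP[bz p].
  by exists z => //; exists ps.
have [N hN] : exists N : nat, B * L < N%:R.
  by exists (Num.truncn (B * L)).+1; rewrite truncnS_gt.
have f : finite_set (\bigcup_(k in `I_N) P k x) by apply: bigcup_finite.
apply: sub_finite_set f => ps [p h]; exists (size ps) => /=.
  rewrite -(ltr_nat R); apply: le_lt_trans hN.
  by apply: le_trans (size_le_plen p) _; rewrite ler_wpM2l// ltW.
by split=> //; exact: path_edge_ge.
Qed.

Lemma finite_argmin (T : choiceType) (S : set T) (f : T -> R) :
  finite_set S -> S !=set0 -> exists2 s, S s & forall t, S t -> f s <= f t.
Proof.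
move=> /finite_seqP[s ->]; elim: s => [[]//|a [|z s] IH _].
  by exists a => [|t]; rewrite /= inE// => /eqP ->.
have [|u us hu] := IH; first by exists z; rewrite /= mem_head.
have [fau|fua] := leP (f a) (f u).
  exists a => [|t]; rewrite /= inE ?eqxx// => /orP[/eqP ->//|ts].
  exact: le_trans fau (hu _ ts).
exists u => [|t]; rewrite /= inE; first by apply/orP; right.
by move=> /orP[/eqP ->|ts]; [exact: ltW|exact: hu].
Qed.

Section Descent.
Variables (D : set X) (y0 : X).
Hypothesis Dy0 : D y0.

Lemma min_path x : exists ps, [/\ is_path b x ps, D (last x ps) &
  forall qs, is_path b x qs -> D (last x qs) -> plen b x ps <= plen b x qs].
Proof.
have [ps0 /andP[p0 /eqP l0]] := b_conn x y0.
(* The summand 1 makes L positive even if [ps0] is empty. Paths longer than L cannot beat the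
   minimiser found below L. *)
pose L := plen b x ps0 + 1.
have L0 : 0 < L by rewrite ltr_wpDl// plen_ge0.
pose S := [set ps | [/\ is_path b x ps, plen b x ps <= L & D (last x ps)]].
have fS : finite_set S.
  by apply: sub_finite_set (finite_paths x L0) => ps [].
have S0 : S !=set0 by exists ps0; split=> //; rewrite ?lerDl// l0.
have [ps [p h Dl] hm] := finite_argmin (plen b x) fS S0.
exists ps; split=> // qs q Dq; have [hq|hq] := leP (plen b x qs) L.
  exact: hm.
by apply: le_trans h _; exact: ltW.
Qed.

(* Following a shortest path to [D] one edge at a time turns the graph into a forest rooted in [D]. *)
Lemma exists_descent : exists (rho : X -> R) (nx : X -> X),
  [/\ forall x, 0 <= rho x,
      forall x, D x -> nx x = x,
      forall x, ~ D x -> 0 < b x (nx x) /\ rho x = (b x (nx x))^-1 + rho (nx x) &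
      forall x ps, is_path b x ps -> D (last x ps) -> rho x <= plen b x ps].
Proof.
have [pm hpm] := choice min_path.
(* The parent of x off D is the first vertex of its chosen shortest path; that path is nonempty
   there, so the default of [head] is never taken. *)
exists (fun x => plen b x (pm x)), (fun x => if `[< D x >] then x else head x (pm x)).
split=> [x|x Dx|x nDx|x ps p Dl]; first exact: plen_ge0.
- by rewrite asboolT.
- rewrite asboolF//; have [] := hpm x; case: (pm x) => [|z ps] //= /andP[bxz p] Dl hm.
  (* The tail of a shortest path is as short as the path chosen at z, since prepending the edge to
     [pm z] gives a competitor at x. *)
  split=> //; congr (_ + _); apply/eqP; rewrite eq_le; have [pz Dz hz] := hpm z.
  rewrite [X in _ && X]hz// andbT.
  have := hm (z :: pm z); rewrite /= bxz => /(_ pz Dz).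
  by rewrite lerD2l.
- by have [_ _] := hpm x; apply.
Qed.

Hypothesis D_dense : rel_dense b D.
Variable x0 : X.
Hypothesis nDx0 : ~ D x0.

(** Every point is within R0 of D, so a ball avoiding D has radius at most R0. Without such a bound
    the [sup] in [inradius] would be a default value. *)
Lemma inradius_ubound : has_ubound
  [set r : R | 0 < r /\ exists2 x, (~` D) x & Uball b r x `<=` ~` D].
Proof.
have [R0 [R00 cov]] := D_dense; exists R0 => r [r0 [x nDx sub]].
rewrite leNgt; apply/negP => lt.
have : (\bigcup_(x in D) Bball b R0 x) x by rewrite cov.
move=> [y Dy yx]; have [ps [p l h]] := dL_lt_path r0 (le_lt_trans yx lt).
have [qs] := path_rev p; rewrite l => -[q lq e].
apply: (sub y) => //; rewrite /Uball/=; apply: le_lt_trans h.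
by rewrite -e -[X in dL b x X]lq; apply: dL_le_plen.
Qed.

(** For x off D, a point of D at distance below rho(x) would be reached by a path shorter than
    rho(x); so the open ball of that radius avoids D and the radius competes in the supremum. Points
    of D are compared with [x0]. *)
Lemma rho_le_inradius (rho : X -> R) :
  (forall x, D x -> rho x <= 0) -> (forall x, 0 <= rho x) ->
  (forall x, ~ D x -> 0 < rho x) ->
  (forall x ps, is_path b x ps -> D (last x ps) -> rho x <= plen b x ps) ->
  forall x, rho x <= inradius b (~` D).
Proof.
move=> rD r0 rn rmin.
have H x : ~ D x -> rho x <= inradius b (~` D).
  move=> nDx; apply: ub_le_sup; first exact: inradius_ubound.
  split; first exact: rn.
  exists x => // y yU Dy; have [ps [p l h]] := dL_lt_path (rn _ nDx) yU.
  by move: h; rewrite ltNge rmin// l.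
move=> x; have [Dx|] := pselect (D x); last exact: H.
exact: le_trans (rD x Dx) (le_trans (r0 x0) (H x0 nDx0)).
Qed.

End Descent.

End PathMetric.

(** * Volume of balls and Poincare inequality *)

Section VolumePoincare.
Context {R : realType} {X : countType}.
Variables (b : X -> X -> R) (m : X -> R) (C Mm : R).
Hypotheses (m_gt0 : forall x, 0 < m x) (b_ge0 : forall x y, 0 <= b x y)
  (b_sym : forall x y, b x y = b y x) (b_summ : forall x, summ (b x))
  (C_gt0 : 0 < C) (deg_le : forall x, sumX setT (b x) <= C * m x)
  (Mm_gt0 : 0 < Mm) (m_le : forall x, m x <= Mm).
Hypothesis b_conn : connected_graph b.

Let B := C * Mm.
Let B_gt0 : 0 < B. Proof. exact: mulr_gt0. Qed.
Let b_le x : sumX setT (b x) <= B.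
Proof. by apply: le_trans (deg_le x) _; rewrite ler_wpM2l// ltW. Qed.
Let m_ge0 x : 0 <= m x. Proof. exact: ltW. Qed.

Lemma meas_indic (A : set X) : meas m A = sumX setT (fun x => m x * (x \in A)%:R).
Proof.
rewrite sumX_fine; last by move=> x; rewrite mulr_ge0.
rewrite /meas esum_mkcond; congr fine; apply: eq_esum => x _.
by case: (x \in A); rewrite ?mulr1 ?mulr0.
Qed.

(** * Uniform volume bound for balls *)

Section Reach.
Variable c : R.
Hypothesis c_gt0 : 0 < c.

Definition reach k x : set X :=
  [set y | exists ps, [/\ size ps = k, path (fun u v => c <= b u v) x ps & last x ps = y]].

(** Split off the first step z of a walk. An admissible step has b(x,z) / c >= 1, so the indicator
    is dominated by a sum over z weighted by b(x,z) / c, and each step costs a factor B / c. *)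
Lemma meas_reach k x : summ (fun y => m y * (y \in reach k x)%:R) /\
  sumX setT (fun y => m y * (y \in reach k x)%:R) <= Mm * (B / c) ^+ k.
Proof.
elim: k x => [|k IH] x.
  have [|s ->] := @sumX_single _ _ x (fun y => m y * (y \in reach 0 x)%:R).
    move=> y yx; rewrite memNset ?mulr0// => -[ps [/size0nil -> _ /= xy]].
    by rewrite xy eqxx in yx.
  split=> //; rewrite expr0 mulr1; apply: le_trans (m_le x).
  by rewrite ler_piMr// lern1 leq_b1.
pose G (p : X * X) := (b x p.1 / c) * (m p.2 * (p.2 \in reach k p.1)%:R).
have bc z : 0 <= b x z / c by rewrite divr_ge0// ltW.
have G0 p : 0 <= G p by rewrite mulr_ge0// mulr_ge0.
have GS z : sumX setT (fun y => G (z, y)) <= (Mm * (B / c) ^+ k / c) * b x z.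
  rewrite (_ : sumX _ _ = b x z / c * sumX setT (fun y => m y * (y \in reach k z)%:R)); last first.
    exact: (sumXZ (b x z / c) (IH z).1).
  rewrite [leRHS](_ : _ = b x z / c * (Mm * (B / c) ^+ k)); last by ring.
  by rewrite ler_wpM2l//; exact: (IH z).2.
have s2 : summ (fun z => (Mm * (B / c) ^+ k / c) * b x z) by exact: summZ.
have s1 : summ (fun z => sumX setT (fun y => G (z, y))).
  apply: summ_le s2 _ => z; rewrite ger0_norm; last exact: sumX_ge0.
  exact: GS.
have sG : summ G.
  apply: summ_prod => [z|]; first exact: (summZ (b x z / c) (IH z).1).
  by apply: eq_summ s1 => z; apply: eq_sumX => y; rewrite ger0_norm.
have sw := summ_sumX (summ_swap sG).
have le y : m y * (y \in reach k.+1 x)%:R <= sumX setT (fun z => G (z, y)).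
  have [/set_mem|_] := boolP (y \in reach k.+1 x); last first.
    by rewrite mulr0; apply: sumX_ge0.
  move=> [[|z ps] [sz p l]]; first by [].
  move: sz p l => /= -[sz] /andP[cz p] l.
  rewrite mulr1; apply: (@le_trans _ _ (G (z, y))); last first.
    apply: (@ler_sumX_term _ _ (fun z => G (z, y))) => //.
    exact: (summ_section y (summ_swap sG)).
  rewrite /G/= mem_set ?mulr1; last by exists ps.
  by rewrite ler_peMl// ler_pdivlMr// mul1r.
have s0 : summ (fun y => m y * (y \in reach k.+1 x)%:R).
  by apply: summ_le sw _ => y; rewrite ger0_norm ?mulr_ge0.
split=> //; apply: le_trans (le_sumX s0 sw le) _.
rewrite -(@exchange_sumX _ _ _ (fun z y => G (z, y))); last by apply: eq_summ sG => -[].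
apply: le_trans (le_sumX s1 s2 GS) _.
rewrite sumXZ// (_ : Mm * (B / c) ^+ k.+1 = Mm * (B / c) ^+ k / c * B); last first.
  by rewrite exprS; ring.
rewrite ler_wpM2l//; do !apply: mulr_ge0; rewrite ?exprn_ge0 ?invr_ge0 ?ltW//.
by rewrite divr_gt0.
Qed.

End Reach.

(** The bound is uniform in the centre, which makes the supremum in [vol] finite. *)
Lemma summ_ball L : exists K : R, forall x, summ (fun y => m y * (y \in Bball b L x)%:R) /\
  sumX setT (fun y => m y * (y \in Bball b L x)%:R) <= K.
Proof.
(* [dL] is an infimum, so a point at distance at most L has a path of length below any larger
   number. Below [L1] such a path has fewer than N edges, all of weight at least 1/L1. *)
pose L1 := `|L| + 1; have L10 : 0 < L1 by rewrite ltr_wpDl.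
have LL1 : L < L1 by rewrite /L1; have := ler_norm L; lra.
have c0 : 0 < L1^-1 by rewrite invr_gt0.
have [N hN] : exists N : nat, B * L1 < N%:R.
  by exists (Num.truncn (B * L1)).+1; rewrite truncnS_gt.
exists (\sum_(k < N) Mm * (B / L1^-1) ^+ k) => x.
pose F (n : nat) y := \sum_(k < n) m y * (y \in reach L1^-1 k x)%:R.
have sF n : summ (F n) /\ sumX setT (F n) <= \sum_(k < n) Mm * (B / L1^-1) ^+ k.
  elim: n => [|n [s h]].
    have F0 : F 0%N = fun=> 0 by apply/funext => y; rewrite /F big_ord0.
    have [//|s e] := @sumX_single _ _ x (fun=> 0 : R).
    by rewrite F0 big_ord0 e.
  have [s1 h1] := meas_reach c0 n x.
  have E : F n.+1 = fun y => F n y + m y * (y \in reach L1^-1 n x)%:R.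
    by apply/funext => y; rewrite /F big_ord_recr.
  rewrite E sumXD// big_ord_recr/=; split; first exact: summD.
  exact: lerD.
have le y : m y * (y \in Bball b L x)%:R <= F N y.
  have t0 k : 0 <= m y * (y \in reach L1^-1 k x)%:R by rewrite mulr_ge0.
  have [/set_mem yB|_] := boolP (y \in Bball b L x); last first.
    by rewrite mulr0; apply: sumr_ge0.
  have [ps [p l h]] := dL_lt_path b_conn L10 (le_lt_trans yB LL1).
  have sN : (size ps < N)%N.
    rewrite -(ltr_nat R); apply: le_lt_trans hN.
    apply: le_trans (size_le_plen b_ge0 b_summ b_le p) _.
    by rewrite ler_wpM2l ?ltW.
  rewrite /F (bigD1 (Ordinal sN))//= mem_set.
    by rewrite lerDl sumr_ge0.
  exists ps; split=> //; exact: (path_edge_ge b_ge0 L10 p (ltW h)).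
have [s h] := sF N.
have s0 : summ (fun y => m y * (y \in Bball b L x)%:R).
  by apply: summ_le s _ => y; rewrite ger0_norm ?mulr_ge0.
by split=> //; apply: le_trans h; apply: le_sumX.
Qed.

Lemma meas_ball_le_vol L x : sumX setT (fun y => m y * (y \in Bball b L x)%:R) <= vol b m L.
Proof.
rewrite -meas_indic; apply: ub_le_sup; last by exists x.
have [K hK] := summ_ball L; exists K => _ [y _ <-].
by rewrite meas_indic; exact: (hK y).2.
Qed.

(** * Poincare inequality off a relatively dense set *)

Section Poincare.
Variables (D : set X) (x0 y0 : X).
Hypotheses (Dy0 : D y0) (nDx0 : ~ D x0) (D_dense : rel_dense b D).
Let I := inradius b (~` D).
Let V := vol b m I.

Lemma vol_ge0 : 0 <= V.
Proof.
by apply: le_trans (meas_ball_le_vol I x0); apply: sumX_ge0 => x; rewrite mulr_ge0.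
Qed.

Section Forest.
Variables (rho : X -> R) (nx : X -> X).
Hypotheses (rho_ge0 : forall x, 0 <= rho x) (nxD : forall x, D x -> nx x = x)
  (rho_step : forall x, ~ D x -> 0 < b x (nx x) /\ rho x = (b x (nx x))^-1 + rho (nx x))
  (rho_le : forall x, rho x <= I).

(** Each forest step off D lowers rho by exactly the edge length, so lengths telescope. The path
    starts at the ancestor because the balls will be centred there. *)
Lemma orbit_path k x : exists ps, [/\ is_path b (iter k nx x) ps,
  last (iter k nx x) ps = x & plen b (iter k nx x) ps = rho x - rho (iter k nx x)].
Proof.
elim: k => [|k [ps [p l e]]]; first by exists [::]; rewrite /= subrr.
rewrite iterS; set v := iter k nx x in p l e *.
have [Dv|nDv] := pselect (D v); first by rewrite nxD//; exists ps.
have [bv rv] := rho_step nDv; exists (v :: ps); split=> //=.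
  by rewrite b_sym bv.
by rewrite e b_sym rv; ring.
Qed.

(** The ancestor relation of the forest: u lies on the tree path from x to D. *)
Definition orb x u := `[< exists k, iter k nx x = u >].

Lemma rho_iter k x : rho (iter k nx x) <= rho x.
Proof.
have [ps [p l e]] := orbit_path k x.
by rewrite -subr_ge0 -e plen_ge0.
Qed.

Lemma orb_ball x u : orb x u -> Bball b I u x.
Proof.
move=> /asboolP[k <-]; have [ps [p l e]] := orbit_path k x.
rewrite /Bball/= -[X in dL b _ X]l; apply: le_trans (dL_le_plen b_ge0 p) _.
by rewrite e; have := rho_ge0 (iter k nx x); have := rho_le x; lra.
Qed.

(** The orbit of [nx x] never returns to x: rho drops strictly at the first step and never increases
    afterwards. *)
Lemma orbE x u : ~ D x -> (orb x u)%:R = (u == x)%:R + (orb (nx x) u)%:R :> R.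
Proof.
move=> nDx; have [bx rx] := rho_step nDx.
have [->|ux] := eqVneq u x.
  rewrite (_ : orb x x = true); last by apply/asboolP; exists 0%N.
  rewrite (_ : orb (nx x) x = false) ?addr0//; apply/asboolPn => -[k kx].
  have := rho_iter k (nx x); rewrite kx rx.
  by move: bx; rewrite -invr_gt0; lra.
rewrite add0r; congr (nat_of_bool _)%:R; apply/asboolP/asboolP => -[k].
  case: k => [/= xu|k]; first by rewrite xu eqxx in ux.
  by rewrite iterSr; exists k.
by move=> h; exists k.+1; rewrite iterSr.
Qed.

Variable f : X -> R.
Hypotheses (lf : l2 m f) (fD : forall x, D x -> f x = 0).
Let e u := b u (nx u) * (f u - f (nx u)) ^+ 2.
Let e_ge0 u : 0 <= e u. Proof. by rewrite mulr_ge0// sqr_ge0. Qed.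

(** The full sum over ordered pairs is twice the energy, and a forest edge appears in it in both
    orientations. Where F is nonzero, p and its swap cannot both be of the form (x, nx x), since rho
    would strictly decrease around a 2-cycle. *)
Lemma edge_energy : summ e /\ sumX setT e <= energy b f f.
Proof.
pose F (p : X * X) := b p.1 p.2 * grad f p ^+ 2.
have sg := (summ_grad b_ge0 b_sym b_summ deg_le lf).1.
have sF : summ F by apply: eq_summ (summZ 2 sg) => p; rewrite /F; field.
have F0 p : 0 <= F p by rewrite mulr_ge0// sqr_ge0.
pose chi (p : X * X) : R := (p.2 == nx p.1)%:R.
have chi0 p : 0 <= chi p by [].
have chi1 p : chi p <= 1 by rewrite /chi lern1 leq_b1.
have sc : summ (fun p => chi p * F p).
  apply: summ_le sF _ => p; rewrite ger0_norm; last exact: mulr_ge0.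
  by rewrite ler_piMl.
have S x : sumX setT (fun y => chi (x, y) * F (x, y)) = e x.
  have [y /negPf yx|_ ->] := @sumX_single _ _ (nx x) (fun y => chi (x, y) * F (x, y)).
    by rewrite /chi/= yx mul0r.
  by rewrite /chi/= eqxx mul1r.
have se : summ e by apply: eq_summ (summ_sumX sc) => x; rewrite S.
have Se : sumX setT e = sumX setT (fun p => chi p * F p).
  by rewrite sumX_prod//; apply: eq_sumX => x; rewrite S.
split=> //.
have Fsym p : F (p.2, p.1) = F p by rewrite /F/grad/= b_sym; ring.
have sc' := summ_swap sc.
have EF : sumX setT F = 2 * energy b f f.
  by rewrite energyE -sumXZ//; apply: eq_sumX => p; rewrite /F; field.
have : sumX setT e + sumX setT e <= sumX setT F; last by lra.
rewrite {1}Se Se [X in _ + X]sumX_swap -sumXD//; apply: le_sumX => //; first exact: summD.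
move=> p; rewrite Fsym -mulrDl; have [->|Fp] := eqVneq (F p) 0; first by rewrite mulr0.
rewrite ler_piMl// /chi/=.
have [p2|_] := eqVneq p.2 (nx p.1); last by rewrite add0r lern1 leq_b1.
have [p1|_] := eqVneq p.1 (nx p.2); last by rewrite addr0.
exfalso; move/eqP: Fp; apply; rewrite /F /grad.
have [D1|n1] := pselect (D p.1).
  by rewrite p2 nxD// subrr expr0n mulr0.
have [D2|n2] := pselect (D p.2).
  by rewrite p1 nxD// subrr expr0n mulr0.
have [b1 r1] := rho_step n1; have [b2 r2] := rho_step n2.
move: b1 b2 r1 r2; rewrite -p1 -p2 -![0 < b _ _]invr_gt0; lra.
Qed.

Let E x := sumX setT (fun u => (orb x u)%:R * e u).

Let summ_orb x : summ (fun u => (orb x u)%:R * e u).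
Proof.
apply: summ_le edge_energy.1 _ => u; rewrite ger0_norm; last exact: mulr_ge0.
by rewrite ler_piMl// lern1 leq_b1.
Qed.

(** Cauchy-Schwarz along the tree path, at whose end f vanishes. The induction is on a bound for B
    rho(x), which each step lowers by at least 1 because edges have length at least 1/B. *)
Lemma forest_path_bound x : f x ^+ 2 <= rho x * E x.
Proof.
have E0 z : 0 <= E z by apply: sumX_ge0 => u; rewrite mulr_ge0.
have [N hN] : exists N : nat, B * rho x <= N%:R.
  by exists (Num.truncn (B * rho x)).+1; rewrite ltW// truncnS_gt.
elim: N x hN => [|N IH] x hN; have [Dx|nDx] := pselect (D x);
  try by rewrite fD// expr0n mulr_ge0.
  have [bx rx] := rho_step nDx; move: hN; rewrite pmulr_rle0// rx.
  by have := rho_ge0 (nx x); move: bx; rewrite -invr_gt0; lra.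
have [bx rx] := rho_step nDx.
have Ex : E x = e x + E (nx x).
  have [y /negPf yx|s1 e1] := @sumX_single _ _ x (fun u => (u == x)%:R * e u).
    by rewrite yx mul0r.
  rewrite eqxx mul1r in e1; rewrite -e1 -sumXD//; apply: eq_sumX => u.
  by rewrite orbE// mulrDl.
have h : f (nx x) ^+ 2 <= rho (nx x) * E (nx x).
  apply: IH; move: hN; rewrite rx mulrDr -natr1.
  have : 1 <= B * (b x (nx x))^-1; last by lra.
  by rewrite ler_pdivlMr// mul1r (edge_le b_ge0 b_summ b_le).
rewrite rx Ex /e; move: h (rho_ge0 (nx x)) (E0 (nx x)).
set r := rho (nx x); set E' := E (nx x); set g := f (nx x); set d := f x - g.
have -> : f x = d + g by rewrite /d; ring.
set w := b x (nx x) in bx *; move=> h r0 E'0.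
have wi : 0 < w^-1 by rewrite invr_gt0.
have w1 : w^-1 * w = 1 by rewrite mulVf// gt_eqF.
have -> : (w^-1 + r) * (w * d ^+ 2 + E') = w^-1 * w * d ^+ 2 + r * E' + (w^-1 * E' + r * (w * d ^+ 2)) by ring.
rewrite w1 mul1r; set P := w^-1 * E'; set Q := r * (w * d ^+ 2).
have P0 : 0 <= P by rewrite mulr_ge0// ltW.
have Q0 : 0 <= Q by rewrite mulr_ge0// mulr_ge0 ?sqr_ge0// ltW.
have PQ : d ^+ 2 * (r * E') = P * Q.
  have -> : P * Q = (w^-1 * w) * (d ^+ 2 * (r * E')) by rewrite /P /Q; ring.
  by rewrite w1 mul1r.
(* The cross term: (2dg)^2 <= 4 d^2 r E' = 4PQ <= (P + Q)^2, by the induction hypothesis g^2 <= r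
   E'. *)
have : 2 * (d * g) <= P + Q.
  have [//|lt] := leP (2 * (d * g)) (P + Q).
  have PQ0 : 0 <= P + Q by rewrite addr_ge0.
  have : (P + Q) ^+ 2 < (2 * (d * g)) ^+ 2.
    by rewrite ltr_pXn2r ?nnegrE// (le_trans PQ0)// ltW.
  have : d ^+ 2 * g ^+ 2 <= d ^+ 2 * (r * E') by rewrite ler_wpM2l ?sqr_ge0.
  rewrite PQ; have := sqr_ge0 (P - Q).
  have -> : (P - Q) ^+ 2 = (P + Q) ^+ 2 - 4 * (P * Q) by ring.
  have -> : (2 * (d * g)) ^+ 2 = 4 * (d ^+ 2 * g ^+ 2) by ring.
  lra.
rewrite sqrrD -mulr_natl; lra.
Qed.

(** Integrate [forest_path_bound] against m, with rho <= I, and exchange the sums. The edge at u is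
    then weighted by the mass W(u) of its descendants, which lie in the ball of radius I about u. *)
Lemma forest_poincare : nsq m f <= I * V * energy b f f.
Proof.
have [se Se] := edge_energy.
have I0 : 0 <= I := le_trans (rho_ge0 x0) (rho_le x0).
have V0 := vol_ge0.
pose W u := sumX setT (fun x => m x * (orb x u)%:R).
have [K hK] := summ_ball I.
have le u x : m x * (orb x u)%:R <= m x * (x \in Bball b I u)%:R.
  rewrite ler_wpM2l// ler_nat; have [/orb_ball/mem_set ->//|//] := boolP (orb x u).
have sW u : summ (fun x => m x * (orb x u)%:R).
  by apply: summ_le (hK u).1 _ => x; rewrite ger0_norm ?mulr_ge0.
have WV u : W u <= V.
  by apply: le_trans (meas_ball_le_vol I u); apply: le_sumX => //; exact: (hK u).1.
pose G (p : X * X) := e p.1 * (m p.2 * (orb p.2 p.1)%:R).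
have G0 p : 0 <= G p by rewrite mulr_ge0// mulr_ge0.
have GS u : sumX setT (fun x => G (u, x)) = e u * W u by exact: (sumXZ (e u) (sW u)).
have s1 : summ (fun u => V * e u) by exact: summZ.
have le1 u : e u * W u <= V * e u by rewrite mulrC ler_wpM2r.
have s2 : summ (fun u => sumX setT (fun x => G (u, x))).
  apply: summ_le s1 _ => u; rewrite ger0_norm; last exact: sumX_ge0.
  by rewrite GS.
have sG : summ G.
  apply: summ_prod => [u|]; first exact: (summZ (e u) (sW u)).
  by apply: eq_summ s2 => u; apply: eq_sumX => x; rewrite ger0_norm.
have sw := summ_sumX (summ_swap sG).
have pw x : m x * f x ^+ 2 <= I * sumX setT (fun u => G (u, x)).
  apply: (@le_trans _ _ (m x * (I * E x))).
    rewrite ler_wpM2l//; apply: le_trans (forest_path_bound x) _.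
    by rewrite ler_wpM2r//; apply: sumX_ge0 => u; rewrite mulr_ge0.
  rewrite mulrCA ler_wpM2l// /E -sumXZ// le_eqVlt; apply/orP; left; apply/eqP.
  by apply: eq_sumX => u; rewrite /G/=; ring.
apply: le_trans (le_sumX lf (summZ I sw) pw) _.
rewrite sumXZ// -mulrA ler_wpM2l//.
rewrite -(@exchange_sumX _ _ _ (fun u x => G (u, x))); last by apply: eq_summ sG => -[].
apply: (@le_trans _ _ (sumX setT (fun u => V * e u))).
  by apply: le_sumX => // u; rewrite GS.
by rewrite sumXZ// ler_wpM2l.
Qed.

End Forest.

Theorem poincare f : l2 m f -> (forall x, D x -> f x = 0) ->
  nsq m f <= I * V * energy b f f.
Proof.
move=> lf fD.
have [rho [nx [r0 nD rs rmin]]] := exists_descent b_ge0 b_summ B_gt0 b_le b_conn Dy0.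
have rI := rho_le_inradius b_ge0 b_sym b_conn D_dense nDx0.
apply: (@forest_poincare rho nx) => //; apply: rI => //.
- by move=> x Dx; apply: (rmin x [::]).
- by move=> x /rs[bx ->]; rewrite ltr_pwDl// invr_gt0.
Qed.

End Poincare.
End VolumePoincare.

(** * Lower bounds for L_r norms *)

(* [f] need not be measurable: the integral is a supremum over simple functions below [f]. *)
Lemma le_integral_indic d (T : measurableType d) (R : realType)
    (mu : {measure set T -> \bar R}) (A : set T) (c : R) (f : T -> \bar R) :
  measurable A -> 0 <= c -> (forall x, 0 <= f x)%E -> (forall x, A x -> c%:E <= f x)%E ->
  (c%:E * mu A <= \int[mu]_x f x)%E.
Proof.
move=> mA c0 f0 cf; rewrite ge0_integralTE//.
pose i := indic_nnsfun R mA; apply: ereal_sup_ubound; exists (scale_nnsfun i c0) => /=.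
  move=> x; change ((c * \1_A x)%:E <= f x)%E; rewrite indicE; have [/set_mem xA|_] := boolP (x \in A).
    by rewrite mulr1 cf.
  by rewrite mulr0.
transitivity (c%:E * sintegral mu i)%E; first exact: sintegralrM.
by rewrite [X in (_ * X)%E]sintegral_indic.
Qed.

Lemma Lnorm_indic_ge {R : realType} (F : R -> R) (N u v : R) (r : \bar R) :
  u < v -> 0 <= N -> (1 <= r)%E -> (forall t, u < t < v -> N <= F t) ->
  ((match r with r'%:E => N * (v - u) `^ (r'^-1) | _ => N end)%:E <=
   Lnorm (@lebesgue_measure R) r (fun t => (\1_[set s | u < s < v] t * F t)%:E))%E.
Proof.
move=> uv N0 r1 NF; pose A := [set s : R | u < s < v].
have AE : A = `]u, v[%classic by apply/seteqP; split => s /=; rewrite in_itv.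
have mA : measurable A by rewrite AE; exact: measurable_itv.
have muA : lebesgue_measure A = (v - u)%:E.
  by rewrite AE lebesgue_measure_itv/= lte_fin uv.
rewrite unlock /Lnorm; case: r r1 => [r|_|//]; last first.
  have -> : (0 < lebesgue_measure [set: R])%E.
    apply: (@lt_le_trans _ _ (lebesgue_measure A)); first by rewrite muA lte_fin subr_gt0.
    by apply: le_measure => //; rewrite inE.
  (* For r = +oo the norm is an essential supremum: an essential bound y < N would make the interval
     negligible. *)
  apply: le_ereal_inf_tmp => y /= hy; rewrite leNgt; apply/negP => yN.
  have nA : (@lebesgue_measure R).-negligible A.
    apply: negligibleS hy => t At /=; apply/negP; rewrite -ltNge.
    apply: lt_le_trans yN _; rewrite indicE mem_set// mul1r lee_fin ger0_norm ?NF//.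
    exact: le_trans N0 (NF _ At).
  have : lebesgue_measure A = 0%E by exact: measure_negligible.
  rewrite muA => -[] /eqP; rewrite subr_eq0 => /eqP vu.
  by rewrite vu ltxx in uv.
rewrite lee_fin => r1; have r0 : 0 < r by apply: lt_le_trans r1.
have ri0 : 0 <= r^-1 by rewrite invr_ge0 ltW.
have Nr0 : 0 <= N `^ r by exact: powR_ge0.
have -> : (N * (v - u) `^ r^-1)%:E = (((N `^ r) * (v - u))%:E `^ r^-1)%E.
  rewrite poweR_EFin powRM//; last by rewrite subr_ge0 ltW.
  by rewrite -powRrM mulfV ?gt_eqF// powRr1.
apply: gt0_ler_poweR => //.
- by rewrite in_itv/= leey andbT lee_fin mulr_ge0// subr_ge0 ltW.
- by rewrite in_itv/= leey andbT; apply: integral_ge0 => x _; rewrite lee_fin powR_ge0.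
rewrite EFinM -muA; apply: le_integral_indic => //; first by move=> x; rewrite lee_fin powR_ge0.
move=> x xA /=; rewrite lee_fin indicE mem_set// mul1r.
have NFx := NF _ xA; have F0 := le_trans N0 NFx.
by rewrite ger0_norm//; apply: ge0_ler_powR; rewrite ?nnegrE// ltW.
Qed.

(** * Observability at a fixed time *)

Section Observability.
Context {R : realType} {X : countType}.
Variables (b : X -> X -> R) (m : X -> R) (C Mm : R).
Hypotheses (m_gt0 : forall x, 0 < m x) (b_ge0 : forall x y, 0 <= b x y)
  (b_sym : forall x y, b x y = b y x) (b_summ : forall x, summ (b x))
  (C_gt0 : 0 < C) (deg_le : forall x, sumX setT (b x) <= C * m x)
  (Mm_gt0 : 0 < Mm) (m_le : forall x, m x <= Mm).
Hypothesis b_conn : connected_graph b.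
Let m_ge0 x : 0 <= m x. Proof. exact: ltW. Qed.
Let C_ge0 : 0 <= C. Proof. exact: ltW. Qed.

(** Extension by zero keeps the restriction a function on X, so norms over A become norms over X and
    the energy form applies. *)
Definition cut (A : set X) (f : X -> R) : X -> R := fun x => if x \in A then f x else 0.

Lemma norm2E A f : norm2 m A f = Num.sqrt (nsq m (cut A f)).
Proof.
rewrite /norm2 /nsq sumX_fine; last by move=> x; rewrite mulr_ge0// sqr_ge0.
congr (Num.sqrt (fine _)); rewrite esum_mkcond; apply: eq_esum => x _.
by rewrite /cut mulrC; case: ifP => //; rewrite expr0n mulr0.
Qed.

Lemma norm2TE f : norm2 m setT f = Num.sqrt (nsq m f).
Proof. by rewrite norm2E; congr (Num.sqrt (nsq m _)); apply/funext => x; rewrite /cut in_setT. Qed.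

Lemma in_l2P f : in_l2 m f <-> l2 m f.
Proof.
rewrite /in_l2 /l2 /summ.
rewrite (_ : \esum_(x in setT) (f x ^+ 2 * m x)%:E = \esum_(x in setT) `|m x * f x ^+ 2|%:E)%E//.
apply: eq_esum => x _; rewrite ger0_norm 1?mulrC//.
by rewrite mulr_ge0// sqr_ge0.
Qed.

Lemma cut_l2 A f : l2 m f -> l2 m (cut A f).
Proof. by move=> lf; apply: l2_le lf _ => // x; rewrite /cut; case: ifP => // _; rewrite normr0. Qed.

(** Makes [opnorm_H1] a genuine supremum, by |Hf + f|^2 <= 2 |Hf|^2 + 2 |f|^2. *)
Lemma opnorm_ubound : has_ubound [set norm2 m setT (fun x => Lap b m f x + f x) |
  f in [set f | in_l2 m f /\ norm2 m setT f <= 1]].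
Proof.
exists (Num.sqrt (2 * (2 * C) ^+ 2 + 2)) => y [f [/in_l2P lf]].
rewrite norm2TE => f1 <-; rewrite norm2TE.
have f1' : nsq m f <= 1.
  rewrite -(@sqr_sqrtr _ (nsq m f)) ?nsq_ge0//.
  by rewrite expr_le1 ?sqrtr_ge0.
have [lh hh] := l2_Lap m_gt0 b_ge0 b_sym b_summ C_ge0 deg_le lf.
apply: ler_wsqrtr; apply: (@le_trans _ _ (2 * nsq m (Lap b m f) + 2 * nsq m f)).
  rewrite -!sumXZ// -sumXD; try exact: summZ.
  apply: le_sumX; [exact: l2D|by apply: summD; exact: summZ|].
  move=> x; rewrite [leRHS](_ : _ = m x * (2 * Lap b m f x ^+ 2 + 2 * f x ^+ 2)); last by ring.
  rewrite ler_wpM2l//.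
  by have := sqr_ge0 (Lap b m f x - f x); nra.
have := sqr_ge0 (2 * C); nra.
Qed.

(** The left side is the inner product of (H + 1)f with f. Normalising f brings it into the unit
    ball over which [opnorm_H1] is taken, and Cauchy-Schwarz concludes. *)
Lemma energy_le_opnorm f : l2 m f ->
  energy b f f + nsq m f <= opnorm_H1 b m * nsq m f.
Proof.
move=> lf; have [n0|n0] := eqVneq (nsq m f) 0.
  have := (summ_grad b_ge0 b_sym b_summ deg_le lf).2; rewrite n0; lra.
have np : 0 < nsq m f by rewrite lt_def n0 nsq_ge0.
pose s := Num.sqrt (nsq m f); have s0 : 0 < s by rewrite sqrtr_gt0.
have s2 : s ^+ 2 = nsq m f by rewrite sqr_sqrtr// ltW.
pose g x := s^-1 * f x.
have lg : l2 m g by exact: l2Z.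
have ng : nsq m g = 1 by rewrite nsqZ// -s2 exprVn mulVf// s2.
have Eg : energy b g g = s^-1 ^+ 2 * energy b f f.
  rewrite !energyE -sumXZ; last exact: (summ_grad b_ge0 b_sym b_summ deg_le lf).1.
  by apply: eq_sumX => p; rewrite /grad /g; ring.
have [lh _] := l2_Lap m_gt0 b_ge0 b_sym b_summ C_ge0 deg_le lg.
set h' := opnorm_H1 b m.
have hle : Num.sqrt (nsq m (fun x => Lap b m g x + g x)) <= h'.
  rewrite -norm2TE; apply: ub_le_sup; first exact: opnorm_ubound.
  by exists g => //; split; [exact/in_l2P|rewrite norm2TE ng sqrtr1].
have h0 : 0 <= h' := le_trans (sqrtr_ge0 _) hle.
have ipE : ip m (fun x => Lap b m g x + g x) g = energy b g g + 1.
  rewrite -ng -ipff -(ip_Lap m_gt0 b_ge0 b_sym b_summ deg_le lg lg) /ip -sumXD.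
  - by apply: eq_sumX => x; rewrite mulrDl mulrDr.
  - exact: summ_ip.
  - exact: summ_ip.
have CS := ip_CS m_gt0 (l2D m_gt0 lh lg) lg.
rewrite ng mulr1 ipE in CS.
have E1 : energy b g g + 1 <= h'.
  have e0 : 0 <= energy b g g + 1 by rewrite addr_ge0// energy_ge0.
  rewrite -ler_sqr ?nnegrE//; apply: le_trans CS _.
  rewrite -(@sqr_sqrtr _ (nsq m _)) ?nsq_ge0// ler_sqr ?nnegrE// sqrtr_ge0//.
rewrite Eg in E1; have := ler_wpM2r (ltW np) E1.
by rewrite mulrDl mul1r -{1}s2 mulrAC -exprMn mulVf ?gt_eqF// expr1n mul1r.
Qed.

Variables (D : set X) (x0 y0 : X).
Hypotheses (Dy0 : D y0) (nDx0 : ~ D x0) (D_dense : rel_dense b D).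
Let I := inradius b (~` D).
Let V := vol b m I.
Let h1 := opnorm_H1 b m.
Let lam := (2 * (I * V))^-1.
Let kappa := 8 * h1 ^+ 2 * I * V.

Let poinc := poincare m_gt0 b_ge0 b_sym b_summ C_gt0 deg_le Mm_gt0 m_le b_conn Dy0 nDx0 D_dense.

(* Testing the Poincare inequality on a point mass off [D]. *)
Lemma inradius_vol_opnorm : 1 <= I * V * (h1 - 1).
Proof.
pose f x : R := (x == x0)%:R.
have [x /negPf xx|lf nf] := @sumX_single _ _ x0 (fun x => m x * f x ^+ 2).
  by rewrite /f xx expr0n mulr0.
have {}nf : nsq m f = m x0 by rewrite /nsq nf /f eqxx expr1n mulr1.
have P : nsq m f <= I * V * energy b f f.
  by apply: poinc => // x Dx; rewrite /f; case: eqP => // xx; rewrite xx in Dx.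
have En := energy_le_opnorm lf; rewrite nf in P En.
have E0 := energy_ge0 b_ge0 f.
(* The sign follows from the Poincare inequality itself: a negative product would give |f|^2 <= 0,
   whereas |f|^2 = m(x0) > 0. *)
have V0 : 0 <= I * V.
  rewrite leNgt; apply/negP => neg.
  have : I * V * energy b f f <= 0 by rewrite mulr_le0_ge0// ltW.
  by have := m_gt0 x0; lra.
rewrite -(ler_pM2r (m_gt0 x0)) mul1r; apply: le_trans P _.
rewrite -[leRHS]mulrA ler_wpM2l// mulrBl mul1r; rewrite -/h1 in En; lra.
Qed.

Lemma IV_ge0 : 0 <= I * V.
Proof.
have V0 : 0 <= V by exact: (vol_ge0 m_gt0 b_ge0 b_summ C_gt0 deg_le Mm_gt0 m_le b_conn D x0).
rewrite mulr_ge0// /I /inradius; set S := (X in sup X).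
have [[r Sr]|/set0P/negP/negPn/eqP ->] := pselect (S !=set0); last by rewrite sup0.
apply: (@le_trans _ _ r); first by case: Sr => /ltW.
by apply: ub_le_sup Sr; exact: inradius_ubound.
Qed.

Lemma IV_gt0 : 0 < I * V.
Proof.
rewrite lt_def IV_ge0 andbT; apply/eqP => e; have := inradius_vol_opnorm.
by rewrite e mul0r ler10.
Qed.

Lemma opnorm_gt1 : 0 < h1 - 1.
Proof. by rewrite -(pmulr_rgt0 _ IV_gt0); apply: lt_le_trans inradius_vol_opnorm. Qed.

Lemma kappa_gt0 : 0 < kappa.
Proof.
have := IV_gt0; have := opnorm_gt1 => h a; rewrite /kappa -mulrA mulr_gt0// mulr_gt0// exprn_gt0//; lra.
Qed.

Lemma low_energy_uncertainty u : l2 m u -> energy b u u <= lam * nsq m u ->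
  nsq m u <= kappa ^+ 2 * nsq m (cut D u).
Proof.
move=> lu Eu; set w := cut D u; pose v := cut (~` D) u.
have [lw lv] : l2 m w /\ l2 m v by split; exact: cut_l2.
have uvw x : u x = v x + w x.
  rewrite /v /w /cut in_setC; case: (x \in D); by rewrite ?add0r ?addr0.
have nE : nsq m u = nsq m v + nsq m w.
  rewrite /nsq -sumXD//; apply: eq_sumX => x.
  by rewrite /v /w /cut in_setC; case: (x \in D); rewrite /= expr0n/= mulr0 ?add0r ?addr0.
have P : nsq m v <= I * V * energy b v v.
  by apply: poinc => // x Dx; rewrite /v /cut in_setC mem_set.
(* (p - q)^2 <= (3/2) p^2 + 3 q^2. As I V lam = 1/2, the factor 3/2 becomes 3/4 in front of |u|^2,
   small enough to be absorbed on the left. *)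
have Ev : energy b v v <= 3 / 2 * energy b u u + 3 * energy b w w.
  have [su sw] := ((summ_grad b_ge0 b_sym b_summ deg_le lu).1, (summ_grad b_ge0 b_sym b_summ deg_le lw).1).
  have sv := (summ_grad b_ge0 b_sym b_summ deg_le lv).1.
  rewrite !energyE -!sumXZ// -sumXD; [|exact: summZ|exact: summZ].
  apply: le_sumX => // [|p]; first by apply: summD; exact: summZ.
  have b2 : 0 <= b p.1 p.2 / 2 by rewrite divr_ge0.
  rewrite [leRHS](_ : _ = b p.1 p.2 / 2 * (3 / 2 * grad u p ^+ 2 + 3 * grad w p ^+ 2)); last by ring.
  rewrite ler_wpM2l//.
  have -> : grad v p = grad u p - grad w p by rewrite /grad !uvw; ring.
  by have := sqr_ge0 (grad u p + 2 * grad w p); nra.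
have Ew := energy_le_opnorm lw; rewrite -/h1 in Ew.
have a1 := inradius_vol_opnorm; have a0 := IV_gt0.
have nw := nsq_ge0 m_gt0 w.
have al : I * V * (lam * nsq m u) = nsq m u / 2.
  have H (a n : R) : 0 < a -> a * ((2 * a)^-1 * n) = n / 2.
    by move=> ap; field; rewrite gt_eqF.
  exact: H.
have q1 : nsq m v <= 3 / 4 * nsq m u + 3 * (I * V * (h1 - 1)) * nsq m w.
  apply: le_trans P _; apply: le_trans (ler_wpM2l (ltW a0) Ev) _.
  have e1 := ler_wpM2l (ltW a0) Eu; rewrite al in e1.
  have Ew' : energy b w w <= (h1 - 1) * nsq m w by lra.
  have e2 := ler_wpM2l (ltW a0) Ew'.
  have -> : I * V * (3 / 2 * energy b u u + 3 * energy b w w) =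
    3 / 2 * (I * V * energy b u u) + 3 * (I * V * energy b w w) by ring.
  lra.
set z := I * V * (h1 - 1) in a1 q1.
(* Absorbing 3/4 of |u|^2 gives |u|^2 <= (12 z + 4) |w|^2, and z >= 1. *)
have q2 : nsq m u <= 16 * z * nsq m w.
  have : nsq m w <= z * nsq m w by rewrite ler_peMl.
  by move: q1; rewrite nE; lra.
apply: le_trans q2 _; rewrite ler_wpM2r//.
(* By completing the square, 8 h^2 = 32 (h - 1) + 8 (h - 2)^2. Then 16 z <= (32 z)^2 <= kappa^2,
   again by z >= 1. *)
have kz : 32 * z <= kappa.
  have -> : kappa = 32 * z + 8 * (I * V) * (h1 - 2) ^+ 2 by rewrite /kappa /z; ring.
  by rewrite lerDl mulr_ge0// ?sqr_ge0// mulr_ge0// ltW.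
have : (32 * z) ^+ 2 <= kappa ^+ 2 by rewrite ler_sqr ?nnegrE//; lra.
nra.
Qed.

Lemma heat_observe phi t T : l2 m phi -> 0 <= t -> t <= T ->
  norm2 m setT (heat b m T phi) <=
  kappa * norm2 m D (heat b m t phi) + expR (- (lam * t)) * norm2 m setT phi.
Proof.
move=> lphi t0 tT; rewrite !norm2TE norm2E.
set u := heat b m t phi.
have lu : l2 m u := heat_l2 m_gt0 b_ge0 b_sym b_summ C_ge0 deg_le lphi t.
have dec := heat_decr m_gt0 b_ge0 b_sym b_summ C_ge0 deg_le lphi tT.
have k0 := kappa_gt0; have lam0 : 0 <= lam by rewrite invr_ge0 mulr_ge0// IV_ge0.
apply: (@le_trans _ _ (Num.sqrt (nsq m u))); first exact: ler_wsqrtr.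
have [le|lt] := leP (lam * nsq m u) (energy b u u).
  have dc := heat_decay m_gt0 b_ge0 b_sym b_summ C_ge0 deg_le lphi t0 lam0 le.
  apply: (@le_trans _ _ (expR (- (lam * t)) * Num.sqrt (nsq m phi))); last first.
    by rewrite lerDr mulr_ge0 ?sqrtr_ge0// ltW.
  rewrite -(ger0_norm (expR_ge0 (- (lam * t)))) -sqrtr_sqr -sqrtrM ?sqr_ge0//.
  apply: ler_wsqrtr; rewrite -(ler_pM2l (expR_gt0 (lam * (2 * t)))).
  apply: le_trans dc _; rewrite mulrA -expRM_natl -expRD.
  by rewrite (_ : _ + _ = 0) ?expR0 ?mul1r//; ring.
have un := low_energy_uncertainty lu (ltW lt).
apply: (@le_trans _ _ (kappa * Num.sqrt (nsq m (cut D u)))); last first.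
  by rewrite lerDl mulr_ge0 ?expR_ge0 ?sqrtr_ge0.
rewrite -[kappa in leRHS]ger0_norm; last exact: ltW.
by rewrite -sqrtr_sqr -sqrtrM ?sqr_ge0//; exact: ler_wsqrtr.
Qed.

End Observability.

(** * Observability over the time interval *)

Unset Implicit Arguments.
Set Strict Implicit. Set Printing Implicit Defensive.

Theorem mainTheorem2 (R : realType) (X : countType)
  (b : X -> X -> R) (m : X -> R)
  (Hm : forall x, 0 < m x)
  (Hb0 : forall x y, 0 <= b x y)
  (Hbsym : forall x y, b x y = b y x)
  (Hbxx : forall x, b x x = 0)
  (Hbsum : forall x, (\esum_(y in setT) (b x y)%:E < +oo)%E)
  (HC : connected_graph b)
  (HB : exists C : R, forall x, Deg b m x <= C)
  (HM : exists C : R, forall x, m x <= C)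
  (D : set X) (HDproper : D `<` setT) (HD : rel_dense b D)
  (T delta : R) (r : \bar R)
  (HT : 0 < T) (Hdelta0 : 0 <= delta) (Hdelta1 : delta < 1) (Hr : (1 <= r)%E) :
  let Omega := ~` D in
  let I := inradius b Omega in
  let lambda := (2 * (I * vol b m I))^-1 in
  let kappa := 8 * opnorm_H1 b m ^+ 2 * I * vol b m I in
  let K := match r with
           | r'%:E => kappa / ((1 - delta) * T) `^ (r'^-1)
           | _ => kappa
           end in
  let alpha := (kappa + 1) * expR (- (delta * lambda * T)) in
  forall phi0 : X -> R, in_l2 m phi0 ->
    ((norm2 m setT (heat b m T phi0))%:E
     <= K%:E * Lnorm (@lebesgue_measure R) r
                  (fun t => (\1_[set s | delta * T < s < T] t
                             * norm2 m D (heat b m t phi0))%:E)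
        + (alpha * norm2 m setT phi0)%:E)%E.
Proof.
move=> Omega I lambda kappa K alpha phi /(in_l2P Hm) lphi.
have [x0 nDx0] : exists x, ~ D x.
  apply: contrapT => h; case: HDproper => _; apply=> x _.
  by apply: contrapT => nDx; apply: h; exists x.
have [y0 Dy0] : exists y, D y.
  have [R0 [_ cov]] := HD; have : [set: X] x0 by [].
  by rewrite -cov => -[y Dy _]; exists y.
have b_summ x : summ (b x) by exact: summ_ge0 (Hb0 x) (Hbsum x).
have [C C0 deg_le] : exists2 C, 0 < C & forall x, sumX setT (b x) <= C * m x.
  have [C hC] := HB; exists (Num.max C 1) => [|x]; first by rewrite lt_max ltr01 orbT.
  rewrite -ler_pdivrMr// mulrC; apply: le_trans (hC x) _.
  by rewrite le_max lexx.
have [M M0 m_le] : exists2 M, 0 < M & forall x, m x <= M.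
  have [M hM] := HM; exists (Num.max M 1) => [|x]; first by rewrite lt_max ltr01 orbT.
  by apply: le_trans (hM x) _; rewrite le_max lexx.
have k0 : 0 < kappa.
  exact: (kappa_gt0 Hm Hb0 Hbsym b_summ C0 deg_le M0 m_le HC Dy0 nDx0 HD).
have lam0 : 0 <= lambda.
  rewrite /lambda invr_ge0 mulr_ge0//.
  exact: (IV_ge0 Hm Hb0 Hbsym b_summ C0 deg_le M0 m_le HC x0 HD).
set n0 := norm2 m setT phi; set nT := norm2 m setT (heat b m T phi).
have n00 : 0 <= n0 by exact: sqrtr_ge0.
pose F t := norm2 m D (heat b m t phi).
have obs t : delta * T < t < T -> nT <= kappa * F t + alpha * n0.
  move=> /andP[dt tT]; have t0 : 0 <= t.
    by apply: le_trans (ltW dt); rewrite mulr_ge0// ltW.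
  have h := heat_observe Hm Hb0 Hbsym b_summ C0 deg_le M0 m_le HC Dy0 nDx0 HD lphi t0 (ltW tT).
  apply: le_trans h _; rewrite lerD2l ler_wpM2r//.
  (* Uses t > delta T, so the bound no longer depends on t; the factor kappa + 1 >= 1 only enlarges
     it to [alpha]. *)
  apply: (@le_trans _ _ (expR (- (delta * lambda * T)))).
    rewrite ler_expR lerN2 mulrAC mulrC -[leRHS]/(lambda * t) ler_wpM2l//.
    exact: ltW.
  by rewrite /alpha ler_peMl ?expR_ge0// lerDr ltW.
(* The constant lower bound for F on the interval that [obs] provides, cut at 0 because the
   difference may be negative. *)
pose N := Num.max 0 ((nT - alpha * n0) / kappa).
have N0 : 0 <= N by rewrite le_max lexx.
have NF t : delta * T < t < T -> N <= F t.
  move=> /obs h; rewrite ge_max sqrtr_ge0/= ler_pdivrMr// mulrC; lra.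
have nTN : nT <= kappa * N + alpha * n0.
  have : (nT - alpha * n0) / kappa <= N by rewrite le_max lexx orbT.
  by rewrite ler_pdivrMr// mulrC; lra.
have dT : delta * T < T by rewrite -[ltRHS]mul1r ltr_pM2r.
have L := Lnorm_indic_ge dT N0 Hr NF.
have dT0 : 0 < (1 - delta) * T by rewrite mulr_gt0// subr_gt0.
have dTE : T - delta * T = (1 - delta) * T by rewrite mulrBl mul1r.
set G := Lnorm _ _ _ in L *.
(* The denominator of K is the r-th root of the interval length, which cancels the L_r norm of the
   indicator. *)
have [K0 KN] : 0 <= K /\ K * (match r with r'%:E => N * (T - delta * T) `^ (r'^-1) | _ => N end) = kappa * N.
  rewrite /K dTE; case: (r) => [r'||]; [|by split=> //; exact: ltW|by split=> //; exact: ltW].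
  have c0 : 0 < ((1 - delta) * T) `^ r'^-1 by exact: powR_gt0.
  split; first by rewrite divr_ge0// ltW.
  by field; rewrite gt_eqF.
apply: (@le_trans _ _ ((kappa * N)%:E + (alpha * n0)%:E)%E); first by rewrite -EFinD lee_fin.
by rewrite leeD2r// -KN EFinM; apply: lee_wpmul2l => //; rewrite lee_fin.
Qed.
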